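(* Let $d\ge 1$, $p\ge 1$, and let $\overline{q}\ge 4$ be an even integer. There exists $\rho=\rho(\overline{q},d)>0$ such that the following holds. If for some $q>3$ with $|q-\overline{q}|<\rho$ there exists $c_{q,d}>0$ such that $$\|\widehat{e^{ig}1_{\mathbb{B}}}\|_q^q\le\|\widehat{1_{\mathbb{B}}}\|_q^q-c_{q,d}\inf_{L}\|e^{i(g-L)}-1\|_{L^p(\mathbb{B})}^2$$ for every measurable function $g:\mathbb{R}^d\to\mathbb{R}$, where the infimum is over all affine functions $L:\mathbb{R}^d\to\mathbb{R}$, then $p\le 2$.
   Context: The Fourier transform is $\widehat{f}(\xi)=\int_{\mathbb{R}^d}e^{-2\pi i x\cdot\xi}f(x)\,dx$, and $\mathbb{B}$ is the unit ball of $\mathbb{R}^d$ centered at the origin. Here $p$ is an arbitrary exponent, not the conjugate of $q$. *)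

(* Defs.v *)
From HB Require Import structures.
From mathcomp Require Import all_boot all_order all_algebra.
From mathcomp Require Import all_classical all_reals all_analysis.
From mathcomp Require Import complex.

Set Implicit Arguments.
Unset Strict Implicit.
Unset Printing Implicit Defensive.
Import Order.TTheory GRing.Theory Num.Theory.
Import numFieldNormedType.Exports.

Local Open Scope classical_set_scope.
Local Open Scope ring_scope.

(* Tuples carry the product sigma-algebra, so the measurable sets are the Borel
   sets of R^n. *)
Notation euclid R n := (n.-tuple (measurableTypeR R)).

Section lebesgue_euclid.
Context {R : realType}.

Definition cons_pair n (z : measurableTypeR R * euclid R n) : euclid R n.+1 :=
  [the n.+1.-tuple _ of z.1 :: z.2].

(* The n-fold product of the one-dimensional Lebesgue measure; R^0 is a point of
   mass 1. *)
Fixpoint lebesgue_euclid n : set (euclid R n) -> \bar R :=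
  match n with
  | 0 => \d_([tuple] : euclid R 0)
  | m.+1 => pushforward (@lebesgue_measure R \x @lebesgue_euclid m)%E
              (@cons_pair m)
  end.

Lemma measurable_cons_pair n : measurable_fun setT (@cons_pair n).
Proof. exact: measurable_cons. Qed.

Let uncons n (x : euclid R n.+1) : measurableTypeR R * euclid R n :=
  (thead x, [tuple of behead x]).

Let measurable_uncons n : measurable_fun setT (@uncons n).
Proof.
apply/measurable_fun_pairP; split => /=.
- exact: measurable_tnth.
- exact: measurable_behead.
Qed.

Let cons_pairK n : cancel (@cons_pair n) (@uncons n).
Proof.
by move=> [x t]; rewrite /uncons theadE; congr pair; exact/val_inj.
Qed.

Let uncons_sigma_finite n (m : {sigma_finite_measure set (euclid R n) -> \bar R}) :
  sigma_finite setT
    (pushforward (@lebesgue_measure R \x m)%E (@cons_pair n)).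
Proof.
have /sigma_finiteP[F [TF ndF Foo]] := sigma_finiteT (@lebesgue_measure R).
have /sigma_finiteP[G [TG ndG Goo]] := sigma_finiteT m.
exists (fun k => @uncons n @^-1` (F k `*` G k)).
  rewrite -preimage_bigcup (_ : \bigcup_k _ = setT) ?preimage_setT//.
  apply/seteqP; split => // -[x y] _.
  have [i _ Fix] : (\bigcup_i F i) x by rewrite -TF.
  have [j _ Gjy] : (\bigcup_j G j) y by rewrite -TG.
  exists (maxn i j) => //; split => /=.
    by move: x Fix; exact/subsetPset/ndF/leq_maxl.
  by move: y Gjy; exact/subsetPset/ndG/leq_maxr.
move=> k; have [mF Fk] := Foo k; have [mG Gk] := Goo k; split.
  rewrite -[X in measurable X]setTI; apply: measurable_uncons => //.
  exact: measurableX.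
rewrite /pushforward -comp_preimage (_ : _ \o _ = id) ?preimage_id; last first.
  by apply/funext => z; exact: cons_pairK.
by rewrite product_measure1E// lte_mul_pinfty// ge0_fin_numE.
Qed.

Let lebesgue_euclid_sigma_finite n :
  {m : {sigma_finite_measure set (euclid R n) -> \bar R}
  | m = @lebesgue_euclid n :> (set _ -> \bar R)}.
Proof.
elim: n => [|n [m mE]].
  by exists (\d_([tuple] : euclid R 0) : {sigma_finite_measure set _ -> \bar R}).
pose p : {measure set (euclid R n.+1) -> \bar R} :=
  measure_function_pushforward__canonical__measure_function_Measure
    (@lebesgue_measure R \x m)%E (@measurable_cons_pair n).
pose s := Measure_isSigmaFinite.Build _ _ _ p (uncons_sigma_finite m).
pose t : {sigma_finite_measure set (euclid R n.+1) -> \bar R} :=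
  HB.pack (p : set _ -> \bar R) p s.
by exists t; rewrite /= mE.
Qed.

Section instances.
Variable n : nat.

Let m := sval (lebesgue_euclid_sigma_finite n).
Let mE : (m : set _ -> \bar R) = @lebesgue_euclid n :=
  svalP (lebesgue_euclid_sigma_finite n).

Let lebesgue_euclid0 : @lebesgue_euclid n set0 = 0%E.
Proof. by rewrite -mE measure0. Qed.

Let lebesgue_euclid_ge0 A : (0 <= @lebesgue_euclid n A)%E.
Proof. by rewrite -mE measure_ge0. Qed.

Let lebesgue_euclid_sigma_additive : semi_sigma_additive (@lebesgue_euclid n).
Proof. by rewrite -mE; exact: measure_semi_sigma_additive. Qed.

HB.instance Definition _ := isMeasure.Build _ _ _ (@lebesgue_euclid n)
  lebesgue_euclid0 lebesgue_euclid_ge0 lebesgue_euclid_sigma_additive.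

Let lebesgue_euclid_sigma_finiteT : sigma_finite setT (@lebesgue_euclid n).
Proof. by rewrite -mE; exact: sigma_finiteT. Qed.

HB.instance Definition _ := Measure_isSigmaFinite.Build _ _ _
  (@lebesgue_euclid n) lebesgue_euclid_sigma_finiteT.

End instances.

Lemma lebesgue_euclid_box n (A : 'I_n -> set (measurableTypeR R)) :
  (forall i, measurable (A i)) ->
  lebesgue_euclid [set x : euclid R n | forall i, A i (tnth x i)]
    = (\prod_(i < n) lebesgue_measure (A i))%E.
Proof.
elim: n A => [|n IHn] A mA.
  by rewrite big_ord0 /= diracE mem_set//= => -[].
rewrite big_ord_recl -IHn; last by move=> i; exact: mA.
rewrite -product_measure1E//; last first.
  rewrite (_ : mkset _ = \bigcap_(i in [set: 'I_n])
      ((fun x : euclid R n => tnth x i) @^-1` A (lift ord0 i))).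
    apply: fin_bigcap_measurable => // i _.
    by rewrite -[X in measurable X]setTI; exact: measurable_tnth.
  by apply/seteqP; split => [x xA i _|x xA i]; [exact: xA|exact: (xA i I)].
rewrite /= /pushforward; congr (product_measure1 _ _ _).
apply/seteqP; split => [[x t] /= xtA|[x t] /= [xA tA] i].
  split; first exact: (xtA ord0).
  by move=> i; have := xtA (lift ord0 i); rewrite tnthS.
case: (unliftP ord0 i) => [j ->|-> //].
by rewrite tnthS; exact: tA.
Qed.

End lebesgue_euclid.

Section complex_functions.
Context {R : realType}.

Definition expi (t : R) : R[i] := Complex (cos t) (sin t).

Definition cintegral d (T : measurableType d)
    (mu : {measure set T -> \bar R}) (f : T -> R[i]) : R[i] :=
  Complex (\int[mu]_x complex.Re (f x)) (\int[mu]_x complex.Im (f x)).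

(* f is extended by 0 off D, which gives the norm of L^p(D) for p <> 0. *)
Definition cLnorm d (T : measurableType d) (mu : {measure set T -> \bar R})
    (p : R) (D : set T) (f : T -> R[i]) : \bar R :=
  'N[mu]_(p%:E)[(fun x => (Normc.normc (f x))%:E) \_ D]%E.

End complex_functions.

Section fourier.
Context {R : realType} {n : nat}.
Implicit Types x y xi : euclid R n.

Definition dot x y : R := \sum_(i < n) tnth x i * tnth y i.

Definition unit_ball : set (euclid R n) := [set x | Num.sqrt (dot x x) <= 1].

Definition fourier (f : euclid R n -> R[i]) xi : R[i] :=
  cintegral (@lebesgue_euclid R n)
    (fun x => expi (- (2 * pi * dot x xi)) * f x).

Definition is_affine (L : euclid R n -> R) : Prop :=
  exists (a : euclid R n) (b : R), forall x, L x = dot a x + b.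

End fourier.

(* Main.v *)
(* Test the inequality on g = (pi/2) 1_E with E a small cube.  Changing the phase
   on E moves the transform of 1_B by at most 4|E| at every frequency, so the
   q-th power of its norm drops by at most C |E|, provided the transform of 1_B
   has a finite L^(q-1) norm; since q - 1 > 2 and the transform is bounded, its
   square integrability suffices.  Conversely, comparing x in E with x + v and
   x - v outside E shows that the distance to every affine phase has squared
   L^p norm at least a constant times |E|^(2/p): an affine L takes its mean at
   the middle point, whereas exp(i pi/2)^2 = -1.  Hence |E|^(2/p) <= C' |E| as
   |E| -> 0, which forces p <= 2.

   Plancherel's theorem is replaced by an upper bound for the L^2 norm of the
   transform: weight it by the product of the functions (1 - (xi_j/N)^2)_+,
   whose transforms are dominated by the approximate identity N/(1 + (N z)^2),
   and let N tend to infinity. *)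

Require Import Defs.
From mathcomp Require Import all_boot all_order all_algebra.
From mathcomp Require Import all_classical all_reals all_analysis.
From mathcomp Require Import complex.
From mathcomp Require Import measurable_realfun.
From mathcomp Require Import ring lra.
Import Order.TTheory GRing.Theory Num.Theory.
Import numFieldNormedType.Exports.
Local Open Scope classical_set_scope.
Local Open Scope ring_scope.

Set Implicit Arguments.
Unset Strict Implicit.

(** * Iterated integrals and translations *)

Section euclid.
Context {R : realType}.
Local Notation leb := (@lebesgue_measure R).
Local Notation lebn n := (@lebesgue_euclid R n).
Local Open Scope ereal_scope.

Lemma ge0_integral_euclidS n (f : euclid R n.+1 -> \bar R) :
  measurable_fun setT f -> (forall x, 0 <= f x) ->
  \int[lebn (n.+1)]_x f x = \int[leb]_t \int[lebn n]_x f (cons_pair (t, x)).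
Proof.
move=> mf f0.
transitivity (\int[leb \x lebn n]_z f (cons_pair z)).
  rewrite -(@ge0_integral_pushforward _ _ _ _ _ _ (@measurable_cons_pair R n) _ setT)//.
rewrite fubini_tonelli1//.
by apply: (measurableT_comp mf); exact: measurable_cons_pair.
Qed.

Lemma integral_euclidS n (f : euclid R n.+1 -> \bar R) :
  (lebn (n.+1)).-integrable setT f ->
  \int[lebn (n.+1)]_x f x = \int[leb]_t \int[lebn n]_x f (cons_pair (t, x)).
Proof.
move=> intf.
have mf : measurable_fun setT f by exact: measurable_int intf.
have ifp : (leb \x lebn n).-integrable setT (f \o @cons_pair R n).
  apply/integrableP; split.
    by apply: (measurableT_comp mf); exact: measurable_cons_pair.
  have /integrableP[_] := intf.
  rewrite [X in X < _](@ge0_integral_pushforward _ _ _ _ _ _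
    (@measurable_cons_pair R n) (leb \x lebn n) setT (abse \o f))//.
    exact: measurableT_comp.
  by move=> x _; exact: abse_ge0.
transitivity (\int[leb \x lebn n]_z (f \o @cons_pair R n) z).
  rewrite -(@integral_pushforward _ _ _ _ _ _ (@measurable_cons_pair R n) _ setT)//.
by rewrite -integral12_prod_meas1.
Qed.

(** The translated measure gives every half-open interval its length, and these intervals determine
    Lebesgue measure. *)
Lemma lebesgue_measure_translate (a : R) (A : set R) : measurable A ->
  pushforward leb (fun t : measurableTypeR R => (t + a)%R : measurableTypeR R) A
  = leb A.
Proof.
have ma : measurable_fun setT
  (fun t : measurableTypeR R => (t + a)%R : measurableTypeR R).
  exact: measurable_funD.
move=> mA; apply/esym.
pose m : {measure set (measurableTypeR R) -> \bar R} :=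
  measure_function_pushforward__canonical__measure_function_Measure leb ma.
apply: (@lebesgue_measure_unique R m) => //= _ [[b c]] _ <-.
rewrite /m /= /pushforward /=.
rewrite (_ : _ @^-1` _ = `](b - a)%R, (c - a)%R]%classic); last first.
  by apply/seteqP; split => x /=; rewrite !in_itv/= ltrBlDr lerBrDr.
rewrite !lebesgue_measure_itv/= !lte_fin ltrD2r.
by case: ifPn => // _; rewrite -!EFinB; congr EFin; ring.
Qed.

Definition shift_head n (a : R) (x : euclid R n.+1) : euclid R n.+1 :=
  cons_pair ((thead x + a)%R : measurableTypeR R, [tuple of behead x]).

Lemma shift_head_cons n a t (x : euclid R n) :
  shift_head a (cons_pair (t, x)) = cons_pair ((t + a)%R : measurableTypeR R, x).
Proof. by rewrite /shift_head theadE; congr (cons_pair (_, _)); exact/val_inj. Qed.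

Lemma measurable_shift_head n a : measurable_fun setT (@shift_head n a).
Proof.
apply: (measurableT_comp (@measurable_cons_pair R n)).
apply: measurable_fun_pair; last exact: measurable_behead.
by apply: measurable_funD => //; exact: measurable_tnth.
Qed.

(** Tonelli makes the first coordinate the inner variable, where one-dimensional translation
    invariance applies. The points compared in the lower bound differ by such shifts. *)
Lemma ge0_integral_shift_head n a (f : euclid R n.+1 -> \bar R) :
  measurable_fun setT f -> (forall x, 0 <= f x) ->
  \int[lebn (n.+1)]_x f (shift_head a x) = \int[lebn (n.+1)]_x f x.
Proof.
move=> mf f0.
have mfa := measurableT_comp mf (@measurable_shift_head n a).
rewrite (ge0_integral_euclidS mf f0).
rewrite (ge0_integral_euclidS mfa (fun x => f0 (shift_head a x))).
transitivity (\int[leb]_t \int[lebn n]_x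
    f (cons_pair ((t + a)%R : measurableTypeR R, x))).
  by apply: eq_integral => t _; apply: eq_integral => x _; rewrite /= shift_head_cons.
have mc := measurableT_comp mf (@measurable_cons_pair R n).
have mca : measurable_fun setT (fun z : measurableTypeR R * euclid R n =>
    f (cons_pair ((z.1 + a)%R : measurableTypeR R, z.2))).
  apply: (measurableT_comp mc); apply: measurable_fun_pair => //=.
  by apply: measurable_funD.
have := fubini_tonelli (m1 := leb) (m2 := lebn n) _ mca (fun z => f0 _).
move=> /= ->.
have := fubini_tonelli (m1 := leb) (m2 := lebn n) _ mc (fun z => f0 _).
move=> /= ->.
apply: eq_integral => y _.
have ma : measurable_fun setT
  (fun t : measurableTypeR R => (t + a)%R : measurableTypeR R).
  exact: measurable_funD.
have my : measurable_fun setT (fun t : measurableTypeR R => f (cons_pair (t, y))).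
  by apply: (measurableT_comp mc); exact: pair2_measurable.
transitivity (\int[pushforward leb
   (fun t : measurableTypeR R => (t + a)%R : measurableTypeR R)]_t f (cons_pair (t, y))).
  by rewrite (ge0_integral_pushforward ma).
by apply: eq_measure_integral => A mA _; exact: lebesgue_measure_translate.
Qed.

Lemma tnth_cons_pair0 n t (x : euclid R n) : tnth (cons_pair (t, x)) ord0 = t.
Proof. by []. Qed.

Lemma tnth_cons_pairS n t (x : euclid R n) i :
  tnth (cons_pair (t, x)) (lift ord0 i) = tnth x i.
Proof. by rewrite tnthS. Qed.

Lemma measurable_prod_tnth n (h : 'I_n -> R -> R) :
  (forall i, measurable_fun setT (h i)) ->
  measurable_fun setT (fun x : euclid R n => \prod_(i < n) h i (tnth x i))%R.
Proof.
move=> mh; apply: measurable_prod => i _.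
by apply: (measurableT_comp (mh i)); exact: measurable_tnth.
Qed.

Lemma ge0_integral_prod n (h : 'I_n -> R -> R) :
  (forall i, measurable_fun setT (h i)) -> (forall i t, (0 <= h i t)%R) ->
  \int[lebn n]_x (\prod_(i < n) h i (tnth x i))%:E
  = \prod_(i < n) \int[leb]_t (h i t)%:E.
Proof.
elim: n h => [|n IHn] h mh h0.
  under eq_integral do rewrite big_ord0.
  by rewrite big_ord0 integral_cst//= diracE in_setT mule1.
rewrite ge0_integral_euclidS; last 2 first.
  by apply/measurable_EFinP; exact: measurable_prod_tnth.
  by move=> x; rewrite lee_fin prodr_ge0.
rewrite big_ord_recl -IHn//.
under eq_integral.
  move=> t _.
  under eq_integral.
    move=> x _; rewrite big_ord_recl tnth_cons_pair0 EFinM.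
    under eq_bigr do rewrite tnth_cons_pairS.
    over.
  rewrite ge0_integralZl//=; last 3 first.
    apply/measurable_EFinP.
    by apply: (@measurable_prod_tnth n (fun i => h (lift ord0 i))).
    by move=> x _; rewrite lee_fin prodr_ge0.
    by rewrite lee_fin.
  over.
rewrite ge0_integralZr//.
- by apply/measurable_EFinP; exact: mh.
- by move=> t _; rewrite lee_fin.
- by apply: integral_ge0 => x _; rewrite lee_fin prodr_ge0.
Qed.

End euclid.

(** * The one-dimensional kernel *)

Section parabolic_weight.
Context {R : realType}.
Local Notation leb := (@lebesgue_measure R).

(** For [N > 0] this is the Bochner-Riesz multiplier of order 1. It increases to 1 with [N], and its
    continuity at the endpoints [-N] and [N] gives a transform with quadratic decay. *)
Definition parabolic_weight (N t : R) : R := Num.max 0 (1 - (t / N) ^+ 2).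

(** The weight is even, so this cosine integral is its whole Fourier transform, at angular frequency
    [z]. *)
Definition parabolic_kernel (N z : R) : R :=
  \int[leb]_t (parabolic_weight N t * cos (z * t)).

Lemma parabolic_weight_ge0 N t : 0 <= parabolic_weight N t.
Proof. by rewrite le_max lexx. Qed.

Lemma parabolic_weight_le1 N t : parabolic_weight N t <= 1.
Proof. by rewrite ge_max ler01/= gerBl sqr_ge0. Qed.

Lemma parabolic_weightN N t : parabolic_weight N (- t) = parabolic_weight N t.
Proof. by rewrite /parabolic_weight mulNr sqrrN. Qed.

Lemma parabolic_weight_le M N t : 0 < M -> M <= N ->
  parabolic_weight M t <= parabolic_weight N t.
Proof.
move=> M0 MN; have N0 := lt_le_trans M0 MN.
rewrite ge_max parabolic_weight_ge0/= le_max; apply/orP; right.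
rewrite lerD2l lerN2 !expr_div_n ler_wpM2l ?sqr_ge0//.
by rewrite lef_pV2 ?posrE ?exprn_gt0// lerXn2r ?nnegrE// ltW.
Qed.

Lemma measurable_parabolic_weight N : measurable_fun setT (parabolic_weight N).
Proof.
apply: measurable_maxr => //; apply: measurable_funB => //.
by apply: measurable_funX; exact: measurable_funM.
Qed.

Lemma parabolic_weight_restrict N : 0 < N ->
  parabolic_weight N = (fun t => 1 - (t / N) ^+ 2) \_ `[- N, N].
Proof.
move=> N0; apply/funext => t; rewrite /parabolic_weight patchE.
have tN : (`|t| <= N) = ((t / N) ^+ 2 <= 1).
  by rewrite -real_normK ?num_real// normrM normfV (gtr0_norm N0)
    expr_le1// ?divr_ge0 ?ler_pdivrMr ?mul1r// ltW.
case: ifPn => [|]; rewrite ?inE ?notin_setE/= in_itv/= -ler_norml tN => h.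
  by rewrite max_r// subr_ge0.
by rewrite max_l// subr_le0 ltW// ltNge; apply/negP.
Qed.

Lemma measurable_cos_comp d (T : measurableType d) (f : T -> R) :
  measurable_fun setT f -> measurable_fun setT (fun t => cos (f t)).
Proof.
move=> mf; apply: (measurableT_comp (f := cos)) => //.
by apply: continuous_measurable_fun; exact: continuous_cos.
Qed.

Lemma measurable_sin_comp d (T : measurableType d) (f : T -> R) :
  measurable_fun setT f -> measurable_fun setT (fun t => sin (f t)).
Proof.
move=> mf; apply: (measurableT_comp (f := sin)) => //.
by apply: continuous_measurable_fun; exact: continuous_sin.
Qed.

Lemma integral_parabolic_weight N (f : R -> R) : 0 < N ->
  (\int[leb]_t (parabolic_weight N t * f t)%:E
  = \int[leb]_(t in `[(- N)%R, N]) ((1 - (t / N) ^+ 2) * f t)%:E)%E.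
Proof.
move=> N0; rewrite [RHS]integral_mkcond; apply: eq_integral => t _.
rewrite (parabolic_weight_restrict N0) !patchE.
by case: ifPn => //; rewrite mul0r.
Qed.

Let continuous_poly N (f : R -> R) : continuous f ->
  continuous (fun t : R => (1 - (t / N) ^+ 2) * f t).
Proof.
move=> cf t; apply: cvgM; last exact: cf.
apply: cvgB; first exact: cvg_cst.
apply: (@continuous_comp _ _ _ (fun t : R => t / N) (fun u => u ^+ 2)).
  by apply: cvgM; [exact: cvg_id|exact: cvg_cst].
exact: exprn_continuous.
Qed.

Lemma continuous_cos_affine (z phi : R) : continuous (fun t : R => cos (z * t + phi)).
Proof.
move=> t; apply: (@continuous_comp _ _ _ (fun t : R => z * t + phi) cos).
  by apply: cvgD; [apply: cvgM; [exact: cvg_cst|exact: cvg_id]|exact: cvg_cst].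
exact: continuous_cos.
Qed.

Lemma integrable_parabolic_weight N : 0 < N ->
  leb.-integrable setT (EFin \o parabolic_weight N).
Proof.
move=> N0; rewrite (parabolic_weight_restrict N0) -restrict_EFin.
apply/integrable_restrict => //; rewrite setTI.
apply: continuous_compact_integrable; first exact: segment_compact.
apply: continuous_subspaceT.
rewrite (_ : (fun t => _) = (fun t : R => (1 - (t / N) ^+ 2) * 1)).
  by apply: continuous_poly => t; exact: cvg_cst.
by apply/funext => t; rewrite mulr1.
Qed.

Lemma integrable_parabolic_weightM N (f : R -> R) : 0 < N ->
  measurable_fun setT f -> (forall t, `|f t| <= 1) ->
  leb.-integrable setT (fun t => (parabolic_weight N t * f t)%:E).
Proof.
move=> N0 mf f1.
apply: (le_integrable _ _ _ (integrable_parabolic_weight N0)) => //.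
  apply/measurable_EFinP; apply: measurable_funM => //.
  exact: measurable_parabolic_weight.
move=> t _ /=; rewrite lee_fin normrM ler_piMr//.
Qed.

Lemma abs_cos_le1 (x : R) : `|cos x| <= 1.
Proof. by rewrite ler_norml cos_geN1 cos_le1. Qed.

Lemma abs_sin_le1 (x : R) : `|sin x| <= 1.
Proof. by rewrite ler_norml sin_geN1 sin_le1. Qed.

Lemma ge0_integralN_lebesgue (f : R -> \bar R) : measurable_fun setT f ->
  (forall t, 0 <= f t)%E -> (\int[leb]_t f (- t)%R = \int[leb]_t f t)%E.
Proof.
move=> mf f0.
have mN : measurable_fun setT (-%R : measurableTypeR R -> measurableTypeR R).
  by apply: continuous_measurable_fun; exact: opp_continuous.
transitivity (\int[pushforward leb
    (-%R : measurableTypeR R -> measurableTypeR R)]_t f t)%E.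
  by rewrite (ge0_integral_pushforward mN).
by apply: eq_measure_integral => A mA _; exact: lebesgue_measureN.
Qed.

Lemma integralN_lebesgue (f : R -> \bar R) : measurable_fun setT f ->
  (\int[leb]_t f (- t)%R = \int[leb]_t f t)%E.
Proof.
move=> mf; rewrite [RHS]integralE [LHS]integralE.
congr (_ - _)%E.
  rewrite -(ge0_integralN_lebesgue (measurable_funepos mf))//.
  by apply: eq_integral => t _; rewrite !funeposE.
rewrite -(ge0_integralN_lebesgue (measurable_funeneg mf))//.
by apply: eq_integral => t _; rewrite !funenegE.
Qed.

(* The weight is even, so only the even part [cos phi * cos (z * t)] of the
   phase contributes. *)
Lemma parabolic_weight_cos N z phi : 0 < N ->
  (\int[leb]_t (parabolic_weight N t * cos (z * t + phi))%:E
  = (parabolic_kernel N z * cos phi)%:E)%E.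
Proof.
move=> N0.
have mz : measurable_fun setT (fun t : R => z * t) by exact: measurable_funM.
have ms := measurable_sin_comp mz.
have ic := integrable_parabolic_weightM N0 (measurable_cos_comp mz)
  (fun t => abs_cos_le1 _).
have is_ := integrable_parabolic_weightM N0 ms (fun t => abs_sin_le1 _).
have S0 : \int[leb]_t (parabolic_weight N t * sin (z * t)) = 0.
  set S := (X in X = _); suff SN : S = - S by lra.
  rewrite -[RHS]mulN1r -RintegralZl//.
  rewrite /S /Rintegral -integralN_lebesgue; last exact: measurable_int is_.
  congr fine; apply: eq_integral => t _.
  by rewrite parabolic_weightN mulrN sinN mulrN mulN1r.
transitivity (\int[leb]_t (cos phi * (parabolic_weight N t * cos (z * t))
   - sin phi * (parabolic_weight N t * sin (z * t)))%:E)%E.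
  by apply: eq_integral => t _; rewrite cosD; congr EFin; ring.
have icZ := integrableZl measurableT (cos phi) ic.
have isZ := integrableZl measurableT (sin phi) is_.
rewrite -[LHS]fineK; last first.
  apply: integrable_fin_num => //.
  under eq_fun do rewrite EFinB !EFinM.
  exact: integrableB.
rewrite -/(Rintegral _ _ _) RintegralB// !RintegralZl//.
by rewrite S0 mulr0 subr0 mulrC.
Qed.

(** Antiderivative of [(1 - (t / N) ^+ 2) * cos (z * t)], found by repeated integration by parts. *)
Let prim (N z t : R) : R :=
  (1 - (t / N) ^+ 2) * (sin (z * t) / z)
  - 2 * t / N ^+ 2 * (cos (z * t) / z ^+ 2) + 2 / N ^+ 2 * (sin (z * t) / z ^+ 3).

Let is_derive_prim (N z t : R) : N != 0 -> z != 0 ->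
  is_derive t 1 (prim N z) ((1 - (t / N) ^+ 2) * cos (z * t)).
Proof.
move=> N0 z0; apply: is_derive_eq.
rewrite /GRing.scale /=; field.
by rewrite N0 z0.
Qed.

(** The factor [1 - (t / N) ^+ 2] vanishes at both endpoints, so the boundary term in [1 / z] drops
    out and the decay is quadratic. *)
Lemma parabolic_kernelE N z : 0 < N -> z != 0 ->
  parabolic_kernel N z
  = 4 * (sin (N * z) / (N ^+ 2 * z ^+ 3) - cos (N * z) / (N * z ^+ 2)).
Proof.
move=> N0 z0; have N0' : N != 0 by rewrite gt_eqF.
rewrite /parabolic_kernel /Rintegral integral_parabolic_weight//.
rewrite (@continuous_FTC2 _ _ (prim N z))/=.
- rewrite /prim !mulrN sinN cosN mulNr sqrrN [z * N]mulrC; field.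
  by rewrite z0 N0'.
- by rewrite (lt_trans _ N0)// oppr_lt0.
- apply: continuous_subspaceT; apply: continuous_poly.
  rewrite (_ : (fun t => _) = (fun t : R => cos (z * t + 0))).
    exact: continuous_cos_affine.
  by apply/funext => t; rewrite addr0.
- have cp : continuous (prim N z).
    move=> t; apply/differentiable_continuous/derivable1_diffP.
    exact: (@ex_derive _ _ _ _ _ _ _ (is_derive_prim t N0' z0)).
  split.
  + by move=> t _; exact: (@ex_derive _ _ _ _ _ _ _ (is_derive_prim t N0' z0)).
  + exact/cvg_at_right_filter/cp.
  + exact/cvg_at_left_filter/cp.
- move=> t _; rewrite derive1E.
  exact: (@derive_val _ _ _ _ _ _ _ (is_derive_prim t N0' z0)).
Qed.

Lemma parabolic_kernel_le N z : 0 < N -> `|parabolic_kernel N z| <= 2 * N.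
Proof.
move=> N0.
have mz : measurable_fun setT (fun t : R => z * t) by exact: measurable_funM.
have ic := integrable_parabolic_weightM N0 (measurable_cos_comp mz)
  (fun t => abs_cos_le1 _).
rewrite -lee_fin /parabolic_kernel EFin_normr_Rintegral//.
rewrite (integral_parabolic_weight (fun t => cos (z * t)))//.
have mh : measurable_fun `[- N, N]
    (fun t => ((1 - (t / N) ^+ 2) * cos (z * t))%:E).
  apply/measurable_EFinP/measurable_funTS.
  apply: measurable_funM; last exact: measurable_cos_comp.
  by apply: measurable_funB => //; apply: measurable_funX; exact: measurable_funM.
apply: le_trans; first exact: (le_abse_integral leb _ mh).
apply: le_trans.
  apply: (@integral_le_bound _ _ _ _ _ _ 1%E) => //.
  apply: aeW => t /=; rewrite in_itv/= -ler_norml => tN.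
  rewrite lee_fin normrM -[leRHS]mul1r ler_pM//; last exact: abs_cos_le1.
  have t1 : (t / N) ^+ 2 <= 1.
    rewrite -real_normK ?num_real// normrM normfV (gtr0_norm N0).
    by rewrite expr_le1// ?divr_ge0 ?ler_pdivrMr ?mul1r// ltW.
  by rewrite ger0_norm ?subr_ge0// gerBl sqr_ge0.
rewrite /= lebesgue_measure_itv/= lte_fin ifT; last by rewrite (lt_trans _ N0)// oppr_lt0.
by rewrite mul1e -EFinB lee_fin; lra.
Qed.

(** With [u = N * z], the trivial bound [2 * N] serves for [|u| <= 1]. For [|u| > 1] the explicit
    formula gives [8 * N / u ^+ 2], and [1 + u ^+ 2 <= 2 * u ^+ 2] turns it into the common form. *)
Lemma parabolic_kernel_bound N z : 0 < N ->
  `|parabolic_kernel N z| <= 16 * N / (1 + (N * z) ^+ 2).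
Proof.
move=> N0; have D0 : 0 < 1 + (N * z) ^+ 2 by rewrite ltr_pwDl// sqr_ge0.
have [u1|u1] := leP `|N * z| 1.
  apply: (le_trans (parabolic_kernel_le _ N0)); rewrite ler_pdivlMr//.
  have : (N * z) ^+ 2 <= 1 by rewrite -real_normK ?num_real// expr_le1.
  by nra.
have z0 : z != 0 by apply/eqP => z0; move: u1; rewrite z0 mulr0 normr0 ltr10.
have N0' : N != 0 by rewrite gt_eqF.
rewrite parabolic_kernelE//.
have -> : 4 * (sin (N * z) / (N ^+ 2 * z ^+ 3) - cos (N * z) / (N * z ^+ 2))
  = 4 * N * (sin (N * z) / (N * z) - cos (N * z)) / (N * z) ^+ 2.
  by field; rewrite z0 N0'.
set u := N * z in u1 D0 *.
rewrite normrM normfV (ger0_norm (sqr_ge0 u)) normrM ger0_norm; last lra.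
have u0 : 0 < u ^+ 2 by rewrite -real_normK ?num_real// exprn_gt0// (lt_trans _ u1).
have u2 : 1 <= u ^+ 2 by rewrite -real_normK ?num_real// expr_ge1// ltW.
have su : `|sin u / u - cos u| <= 2.
  apply: (le_trans (ler_normB _ _)); rewrite -[leRHS]/(1 + 1 : R) lerD ?abs_cos_le1//.
  rewrite normrM normfV ler_pdivrMr ?mul1r ?(lt_trans _ u1)//.
  by rewrite (le_trans (abs_sin_le1 _))// ltW.
rewrite ler_pdivrMr// [leRHS]mulrAC ler_pdivlMr//.
have N4 : 0 <= 4 * N by lra.
have h1 : 4 * N * `|sin u / u - cos u| <= 8 * N.
  by have := ler_wpM2l N4 su; lra.
apply: (@le_trans _ _ (8 * N * (1 + u ^+ 2))); last by nra.
by rewrite ler_wpM2r// ltW.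
Qed.

Lemma continuous_parabolic_bound (N a c : R) :
  continuous (fun t : R => 16 * N / (1 + (N * (a * (c - t))) ^+ 2)).
Proof.
move=> t; apply: cvgM; first exact: cvg_cst.
apply: cvgV; first by rewrite gt_eqF// ltr_pwDl// sqr_ge0.
apply: cvgD; first exact: cvg_cst.
apply: (@continuous_comp _ _ _ (fun t : R => N * (a * (c - t))) (fun u => u ^+ 2)).
  apply: cvgM; first exact: cvg_cst.
  apply: cvgM; first exact: cvg_cst.
  by apply: cvgB; [exact: cvg_cst|exact: cvg_id].
exact: exprn_continuous.
Qed.

Lemma atanB_le_pi (x y : R) : atan x - atan y <= pi.
Proof. by have := atan_ltpi2 x; have := atan_gtNpi2 y; lra. Qed.

(* The bound does not depend on [N]: the kernels form an approximate identity. *)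
Lemma integral_parabolic_kernel_bound N a c : 0 < N -> 0 < a ->
  (\int[leb]_(t in `[(-1)%R, 1%R])
     (16 * N / (1 + (N * (a * (c - t))) ^+ 2))%:E <= (16 * pi / a)%:E)%E.
Proof.
move=> N0 a0; have pi0 := pi_gt0 R.
(* The integrand is the derivative of this arctangent, whose increments are at most [16 * pi / a]
   whatever [N] is. *)
pose F (t : R) := - (16 / a) * atan (N * (a * (c - t))).
have D0 t : 0 < 1 + (N * (a * (c - t))) ^+ 2 by rewrite ltr_pwDl// sqr_ge0.
have dF (t : R) : is_derive t 1 F (16 * N / (1 + (N * (a * (c - t))) ^+ 2)).
  have := D0 t => D0t.
  apply: is_derive_eq; rewrite /GRing.scale /=; field.
  by rewrite !gt_eqF.
have cF : continuous F.
  move=> t; apply/differentiable_continuous/derivable1_diffP.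
  exact: (@ex_derive _ _ _ _ _ _ _ (dF t)).
rewrite (@continuous_FTC2 _ _ F)//.
- rewrite -EFinB lee_fin /F.
  rewrite -mulrBr mulNr -mulrN opprB [leRHS]mulrAC.
  by apply: ler_wpM2l; [rewrite divr_ge0// ltW|exact: atanB_le_pi].
- by apply: continuous_subspaceT; exact: continuous_parabolic_bound.
- split => [t _||].
  + exact: (@ex_derive _ _ _ _ _ _ _ (dF t)).
  + exact/cvg_at_right_filter/cF.
  + exact/cvg_at_left_filter/cF.
- move=> t _; rewrite derive1E.
  exact: (@derive_val _ _ _ _ _ _ _ (dF t)).
Qed.

End parabolic_weight.

(** * Integrability on products for Fubini's theorem *)

Section fubini_bounded.
Context d1 d2 (T1 : measurableType d1) (T2 : measurableType d2) (R : realType).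
Context (m1 : {sigma_finite_measure set T1 -> \bar R})
        (m2 : {sigma_finite_measure set T2 -> \bar R}).

(** Domination by a multiple of the separable function [u z.1 * v z.2]. It justifies exchanging the
    frequency integral with the space integrals in [weighted_square_le]. *)
Lemma integrable_prodM_bounded (u : T1 -> R) (v : T2 -> R) (g : T1 * T2 -> R) (c : R) :
  m1.-integrable setT (EFin \o u) -> m2.-integrable setT (EFin \o v) ->
  measurable_fun setT g -> (forall z, `|g z| <= c) ->
  (m1 \x m2)%E.-integrable setT (fun z => (u z.1 * v z.2 * g z)%:E).
Proof.
move=> iu iv mg g1.
have mu : measurable_fun setT u by apply/measurable_EFinP; exact: measurable_int iu.
have mv : measurable_fun setT v by apply/measurable_EFinP; exact: measurable_int iv.
have muv : measurable_fun setT (fun z : T1 * T2 => u z.1 * v z.2).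
  by apply: measurable_funM; exact: measurableT_comp.
have iuv : (m1 \x m2)%E.-integrable setT (fun z => (u z.1 * v z.2)%:E).
  apply/integrable12ltyP; first exact/measurable_EFinP.
  have -> : (fun x => \int[m2]_y `|(u (x, y).1 * v (x, y).2)%:E|)%E
     = (fun x => (`|u x|)%:E * \int[m2]_y (`|v y|)%:E)%E.
    apply/funext => x /=; under eq_integral do rewrite normrM EFinM.
    rewrite ge0_integralZl//; apply/measurable_EFinP.
    exact: measurableT_comp.
  rewrite ge0_integralZr//=.
  - move/integrableP : iu => [_ iu]; move/integrableP : iv => [_ iv].
    rewrite lte_mul_pinfty//; first exact: integral_ge0.
    by rewrite ge0_fin_numE//; exact: integral_ge0.
  - by apply/measurable_EFinP; exact: measurableT_comp.
  - exact: integral_ge0.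
have iuvc := integrableZr measurableT c iuv.
apply: (le_integrable _ _ _ iuvc) => //.
  by apply/measurable_EFinP; exact: measurable_funM.
move=> z _; rewrite /= lee_fin !normrM ler_wpM2l//.
by rewrite (le_trans (g1 z))// ler_norm.
Qed.

End fubini_bounded.

Lemma integral_le_ge0 d (T : measurableType d) (R : realType)
    (mu : {measure set T -> \bar R}) (f g : T -> \bar R) :
  measurable_fun setT f -> measurable_fun setT g ->
  (forall x, `|f x| <= g x)%E -> (\int[mu]_x f x <= \int[mu]_x g x)%E.
Proof.
move=> mf mg fg.
apply: (le_trans (lee_abs _)); apply: (le_trans (le_abse_integral _ _ mf)) => //.
by apply: ge0_le_integral => //; exact: measurableT_comp.
Qed.

(** * The product weight and its transform *)

Section weight_euclid.
Context {R : realType}.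
Local Notation leb := (@lebesgue_measure R).
Local Notation lebn n := (@lebesgue_euclid R n).

Definition cube_weight n N (x : euclid R n) : R :=
  \prod_(i < n) parabolic_weight N (tnth x i).

Lemma cube_weight_ge0 n N (x : euclid R n) : 0 <= cube_weight N x.
Proof. by rewrite prodr_ge0// => i _; exact: parabolic_weight_ge0. Qed.

Lemma measurable_cube_weight n N : measurable_fun setT (@cube_weight n N).
Proof.
apply: (@measurable_prod_tnth _ _ (fun=> parabolic_weight N)) => i.
exact: measurable_parabolic_weight.
Qed.

Lemma integrable_cube_weight n N : 0 < N ->
  (lebn n).-integrable setT (EFin \o @cube_weight n N).
Proof.
move=> N0; apply/integrableP; split.
  by apply/measurable_EFinP; exact: measurable_cube_weight.
under eq_integral do rewrite gee0_abs ?lee_fin ?cube_weight_ge0//.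
rewrite (@ge0_integral_prod _ _ (fun=> parabolic_weight N)); last 2 first.
- by move=> i; exact: measurable_parabolic_weight.
- by move=> i t; exact: parabolic_weight_ge0.
rewrite -ge0_fin_numE; last first.
  apply: prode_ge0 => i _; apply: integral_ge0 => t _.
  by rewrite lee_fin parabolic_weight_ge0.
apply: prode_fin_num => i _; apply: integrable_fin_num => //.
exact: integrable_parabolic_weight.
Qed.

Lemma measurable_lin_form n (z : 'I_n -> R) (phi : R) :
  measurable_fun setT (fun x : euclid R n => \sum_(i < n) z i * tnth x i + phi).
Proof.
apply: measurable_funD => //; apply: measurable_sum => i.
by apply: measurable_funM => //; exact: measurable_tnth.
Qed.

Lemma integrable_cube_weight_cos n N (z : 'I_n -> R) phi : 0 < N ->
  (lebn n).-integrable setT (fun x =>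
     (cube_weight N x * cos (\sum_(i < n) z i * tnth x i + phi))%:E).
Proof.
move=> N0; apply: (le_integrable _ _ _ (integrable_cube_weight n N0)) => //.
  apply/measurable_EFinP; apply: measurable_funM; first exact: measurable_cube_weight.
  by apply: measurable_cos_comp; exact: measurable_lin_form.
by move=> t _ /=; rewrite lee_fin normrM ler_piMr// abs_cos_le1.
Qed.

(** The free phase [phi] carries the induction on the dimension: for the remaining coordinates,
    [z ord0 * t + phi] is again a constant phase, and [parabolic_weight_cos] then integrates out
    [t]. *)
Lemma cube_weight_cos n N (z : 'I_n -> R) phi : 0 < N ->
  (\int[lebn n]_x
     (cube_weight N x * cos (\sum_(i < n) z i * tnth x i + phi))%:E
  = (\prod_(i < n) parabolic_kernel N (z i) * cos phi)%:E)%E.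
Proof.
move=> N0; elim: n z phi => [|n IHn] z phi.
  under eq_integral do rewrite /cube_weight !big_ord0 add0r mul1r.
  by rewrite integral_cst//= diracE in_setT mule1 big_ord0 mul1r.
rewrite integral_euclidS; last exact: integrable_cube_weight_cos.
transitivity (\int[leb]_t ((parabolic_weight N t * cos (z ord0 * t + phi))%:E
   * (\prod_(i < n) parabolic_kernel N (z (lift ord0 i)))%:E))%E.
  apply: eq_integral => t _.
  transitivity (\int[lebn n]_x ((parabolic_weight N t)%:E *
     (cube_weight N x * cos (\sum_(i < n) z (lift ord0 i) * tnth x i
        + (z ord0 * t + phi)))%:E))%E.
    apply: eq_integral => x _; rewrite -EFinM; congr EFin.
    rewrite /cube_weight !big_ord_recl !tnth_cons_pair0.
    under eq_bigr do rewrite tnth_cons_pairS.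
    under [in cos _]eq_bigr do rewrite tnth_cons_pairS.
    rewrite mulrA; congr (_ * cos _); ring.
  rewrite integralZl//; last exact: integrable_cube_weight_cos.
  by rewrite IHn -!EFinM; congr EFin; ring.
have mz : measurable_fun setT (fun t : R => z ord0 * t + phi).
  by apply: measurable_funD => //; exact: measurable_funM.
rewrite integralZr//; last first.
  apply: integrable_parabolic_weightM => //; last by move=> t; exact: abs_cos_le1.
  exact: measurable_cos_comp.
by rewrite parabolic_weight_cos// -EFinM big_ord_recl; congr EFin; ring.
Qed.

End weight_euclid.

(** Tonelli's measurability statement, applied separately to the positive and negative parts. *)
Lemma measurable_Rintegral_param d1 d2 (T1 : measurableType d1)
    (T2 : measurableType d2) (R : realType)
    (m2 : {sigma_finite_measure set T2 -> \bar R}) (f : T1 * T2 -> R) :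
  measurable_fun setT f ->
  measurable_fun setT (fun x => \int[m2]_y f (x, y)).
Proof.
move=> mf; apply: measurableT_comp => //.
have mf' : measurable_fun setT (EFin \o f) by exact/measurable_EFinP.
rewrite (_ : (fun x => _) = (fun x => \int[m2]_y ((EFin \o f)^\+ (x, y))
   - \int[m2]_y ((EFin \o f)^\- (x, y)))%E); last first.
  apply/funext => x; rewrite integralE.
  by congr (_ - _)%E; apply: eq_integral => y _; rewrite ?funeposE ?funenegE.
apply: emeasurable_funB.
- apply: (@measurable_fun_fubini_tonelli_F _ _ _ _ _ m2 (EFin \o f)^\+%E) => //.
  exact: measurable_funepos.
- apply: (@measurable_fun_fubini_tonelli_F _ _ _ _ _ m2 (EFin \o f)^\-%E) => //.
  exact: measurable_funeneg.
Qed.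

Lemma measurable_dot (R : realType) n d (T : measurableType d)
    (f g : T -> euclid R n) : measurable_fun setT f -> measurable_fun setT g ->
  measurable_fun setT (fun t => dot (f t) (g t)).
Proof.
move=> mf mg; apply: measurable_sum => i; apply: measurable_funM.
  exact: (measurableT_comp (measurable_tnth i) mf).
exact: (measurableT_comp (measurable_tnth i) mg).
Qed.

Lemma measurable_parabolic_kernel (R : realType) (N : R) :
  measurable_fun setT (parabolic_kernel N).
Proof.
apply: (@measurable_Rintegral_param _ _ R (measurableTypeR R) R
  (@lebesgue_measure R)
  (fun z : R * measurableTypeR R => parabolic_weight N z.2 * cos (z.1 * z.2))).
apply: measurable_funM.
  exact: (measurableT_comp (measurable_parabolic_weight N) measurable_snd).
by apply: measurable_cos_comp; exact: measurable_funM.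
Qed.

Lemma lee_prod (R : realType) (I : finType) (f g : I -> \bar R) :
  (forall i, 0 <= f i)%E -> (forall i, f i <= g i)%E ->
  (\prod_i f i <= \prod_i g i)%E.
Proof.
move=> f0 fg.
suff : (0 <= \prod_i f i /\ \prod_i f i <= \prod_i g i)%E by case.
elim/big_ind2 : _ => [//|a b c e [a0 ab] [c0 ce]|//].
by split; [exact: mule_ge0|exact: lee_pmul].
Qed.

Lemma measurable_box (R : realType) n (A : 'I_n -> set (measurableTypeR R)) :
  (forall i, measurable (A i)) ->
  measurable [set x : euclid R n | forall i, A i (tnth x i)].
Proof.
move=> mA; rewrite (_ : [set x | _] = \bigcap_(i in [set: 'I_n])
    ((fun x : euclid R n => tnth x i) @^-1` A i)).
  apply: fin_bigcap_measurable => // i _.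
  by rewrite -[X in measurable X]setTI; exact: measurable_tnth.
by apply/seteqP; split => [x xA i _|x xA i]; [exact: xA|exact: (xA i I)].
Qed.

(** * Square integrability of the transform of an indicator *)

Section square_integrable.
Context {R : realType} {n : nat}.
Local Notation leb := (@lebesgue_measure R).
Local Notation mu := (@lebesgue_euclid R n).
Variable B : set (euclid R n).
Hypotheses (mB : measurable B) (B1 : forall x, B x -> forall i, -1 <= tnth x i <= 1).

(** The real part of the transform of [\1_B]; [sin_transform] is minus its imaginary part. The sum
    of their squares is therefore the squared modulus. *)
Definition cos_transform (xi : euclid R n) : R :=
  \int[mu]_x (cos (2 * pi * dot x xi) * \1_B x).

Definition sin_transform (xi : euclid R n) : R :=
  \int[mu]_x (sin (2 * pi * dot x xi) * \1_B x).

Lemma measure_lty_of_cube : (mu B < +oo)%E.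
Proof.
have := @lebesgue_euclid_box R n (fun=> `[-1, 1]%classic)
  (fun i => measurable_itv _).
rewrite (eq_bigr (fun=> 2%:E))/=; last first.
  by move=> i _; rewrite lebesgue_measure_itv/= lte_fin gtrN// -EFinB opprK.
move=> h; apply: (@le_lt_trans _ _ (\prod_(i < n) 2%:E)%E).
  rewrite -h; apply: le_measure; rewrite ?inE//.
  exact: (@measurable_box R n (fun=> `[-1, 1]%classic)).
by rewrite prodEFin ltry.
Qed.

Let integrable_B : mu.-integrable setT (EFin \o (\1_B : _ -> R)).
Proof.
apply/integrableP; split; first exact/measurable_EFinP.
under eq_integral do rewrite gee0_abs ?lee_fin//=.
by rewrite integral_indic// setIT measure_lty_of_cube.
Qed.

Lemma integrable_indicM (f : euclid R n -> R) : measurable_fun setT f ->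
  (forall x, `|f x| <= 1) -> mu.-integrable setT (fun x => (f x * \1_B x)%:E).
Proof.
move=> mf f1; apply: (le_integrable _ _ _ integrable_B) => //.
  by apply/measurable_EFinP; exact: measurable_funM.
move=> x _; rewrite lee_fin normrM ler_piMl//.
Qed.

Let measurable_cos_phase xi : measurable_fun setT
  (fun x : euclid R n => cos (2 * pi * dot x xi)).
Proof.
by apply: measurable_cos_comp; apply: measurable_funM => //; exact: measurable_dot.
Qed.

Let measurable_sin_phase xi : measurable_fun setT
  (fun x : euclid R n => sin (2 * pi * dot x xi)).
Proof.
by apply: measurable_sin_comp; apply: measurable_funM => //; exact: measurable_dot.
Qed.

Lemma measurable_cos_transform : measurable_fun setT cos_transform.
Proof.
apply: (@measurable_Rintegral_param _ _ _ _ _ mu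
  (fun z => cos (2 * pi * dot z.2 z.1) * \1_B z.2)).
apply: measurable_funM.
  by apply: measurable_cos_comp; apply: measurable_funM => //; exact: measurable_dot.
exact: (measurableT_comp (f := (\1_B : euclid R n -> R))).
Qed.

Lemma measurable_sin_transform : measurable_fun setT sin_transform.
Proof.
apply: (@measurable_Rintegral_param _ _ _ _ _ mu
  (fun z => sin (2 * pi * dot z.2 z.1) * \1_B z.2)).
apply: measurable_funM.
  by apply: measurable_sin_comp; apply: measurable_funM => //; exact: measurable_dot.
exact: (measurableT_comp (f := (\1_B : euclid R n -> R))).
Qed.

Lemma Rintegral_indic_le (f : euclid R n -> R) : measurable_fun setT f ->
  (forall x, `|f x| <= 1) -> `|\int[mu]_x (f x * \1_B x)| <= fine (mu B).
Proof.
move=> mf f1; have ifB := integrable_indicM mf f1.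
apply: (le_trans (le_normr_Rintegral _ ifB)) => //.
have -> : fine (mu B) = \int[mu]_x \1_B x.
  by rewrite /Rintegral integral_indic// setIT.
apply: le_Rintegral => //.
- exact: integrable_norm.
- by move=> x _; rewrite normrM [`|\1_B x|]ger0_norm// ler_piMl.
Qed.

Let phaseB (x y xi : euclid R n) :
  2 * pi * dot x xi - 2 * pi * dot y xi
  = \sum_(i < n) 2 * pi * (tnth x i - tnth y i) * tnth xi i + 0.
Proof.
rewrite addr0 /dot !mulr_sumr -sumrB; apply: eq_bigr => i _; ring.
Qed.

(** By the subtraction formula for the cosine, this is the integral of
    [cos (2 * pi * (dot x xi - dot y xi))] over [y] in [B]. Integrating it once more over [x] in [B]
    gives the squared modulus of the transform at [xi]. *)
Let G (xi x : euclid R n) : R :=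
  cos (2 * pi * dot x xi) * cos_transform xi
  + sin (2 * pi * dot x xi) * sin_transform xi.

Let GE (c : R) xi x : (c * G xi x)%:E =
  (\int[mu]_y (c * \1_B y * cos (2 * pi * dot x xi - 2 * pi * dot y xi))%:E)%E.
Proof.
have ic := integrable_indicM (measurable_cos_phase xi) (fun x => abs_cos_le1 _).
have is_ := integrable_indicM (measurable_sin_phase xi) (fun x => abs_sin_le1 _).
have icZ := integrableZl measurableT (c * cos (2 * pi * dot x xi)) ic.
have isZ := integrableZl measurableT (c * sin (2 * pi * dot x xi)) is_.
transitivity (\int[mu]_y
   (c * cos (2 * pi * dot x xi) * (cos (2 * pi * dot y xi) * \1_B y)
   + c * sin (2 * pi * dot x xi) * (sin (2 * pi * dot y xi) * \1_B y))%:E)%E;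
  last by apply: eq_integral => y _; rewrite cosB; congr EFin; ring.
rewrite -[RHS]fineK; last first.
  apply: integrable_fin_num => //.
  under eq_fun do rewrite EFinD !(EFinM (c * _)).
  exact: integrableD.
rewrite -/(Rintegral _ _ _) RintegralD// !RintegralZl//.
by rewrite /G /cos_transform /sin_transform; congr EFin; ring.
Qed.

Let measurable_kernel_integrand N (x : euclid R n) :
  measurable_fun setT (fun y : euclid R n => (\1_B y * `|\prod_(i < n)
     parabolic_kernel N (2 * pi * (tnth x i - tnth y i))|)%:E).
Proof.
apply/measurable_EFinP; apply: measurable_funM => //.
apply: measurableT_comp => //.
apply: (@measurable_prod_tnth _ _ (fun i t =>
  parabolic_kernel N (2 * pi * (tnth x i - t)))) => i.
apply: (measurableT_comp (measurable_parabolic_kernel N)).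
by apply: measurable_funM => //; exact: measurable_funB.
Qed.

(** Enlarging [B] to the cube of half-side 1 lets the integral of the dominating functions factor
    over the coordinates. Each factor is at most [16 * pi / (2 * pi) = 8]. *)
Let kernel_le N (x : euclid R n) : 0 < N ->
  (\int[mu]_y (\1_B y * `|\prod_(i < n)
     parabolic_kernel N (2 * pi * (tnth x i - tnth y i))|)%:E <= (8 ^+ n)%:E)%E.
Proof.
move=> N0; have pi0 := pi_gt0 R.
pose k (i : 'I_n) (t : R) := 16 * N / (1 + (N * (2 * pi * (tnth x i - t))) ^+ 2).
have k0 i t : 0 <= k i t.
  by rewrite divr_ge0// ?addr_ge0 ?sqr_ge0// mulr_ge0// ltW.
have mk i : measurable_fun setT (k i).
  by apply: continuous_measurable_fun; exact: continuous_parabolic_bound.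
pose h (i : 'I_n) (t : R) := \1_`[-1, 1]%classic t * k i t.
have mh i : measurable_fun setT (h i) by exact: measurable_funM.
have h0 i t : 0 <= h i t by rewrite mulr_ge0.
apply: (@le_trans _ _ (\int[mu]_y (\prod_(i < n) h i (tnth y i))%:E)%E).
  apply: ge0_le_integral => //.
  - by apply/measurable_EFinP; exact: (@measurable_prod_tnth _ _ h).
  - move=> y _; rewrite lee_fin.
    have [yB|yB] := boolP (y \in B); last first.
      by rewrite indicE (negbTE yB) mul0r prodr_ge0.
    rewrite indicE yB mul1r normr_prod; apply: ler_prod => i _.
    rewrite normr_ge0/= /h indicE mem_set ?mul1r.
      exact: parabolic_kernel_bound.
    by move/set_mem : yB => /B1 /(_ i); rewrite /= in_itv.
rewrite ge0_integral_prod//.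
apply: (@le_trans _ _ (\prod_(i < n) 8%:E)%E); last first.
  by rewrite prodEFin prodr_const card_ord.
apply: lee_prod => i.
  by apply: integral_ge0 => t _; rewrite lee_fin.
have := @integral_parabolic_kernel_bound R N (2 * pi) (tnth x i) N0.
have -> : 16 * pi / (2 * pi) = 8 :> R.
  by rewrite -mulf_div divff ?gt_eqF// mulr1; field.
move=> /(_ _)/(le_trans _); apply; last by rewrite mulr_gt0.
rewrite (_ : \int[leb]_t (h i t)%:E = \int[leb]_(t in `[(-1)%R, 1%R]) (k i t)%:E)%E//.
rewrite [RHS]integral_mkcond; apply: eq_integral => t _.
by rewrite patchE /h indicE; case: ifPn => _; rewrite ?mul1r ?mul0r.
Qed.

(** The squared modulus is a double integral of cosines over [B] times [B]. Performing the frequency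
    integral first leaves a product of kernels in [x - y], whose integral over [y] is at most
    [8 ^+ n] uniformly in [N]; the integral over [x] then contributes the measure of [B]. *)
Lemma weighted_square_le N : 0 < N ->
  (\int[mu]_xi (cube_weight N xi
     * (cos_transform xi ^+ 2 + sin_transform xi ^+ 2))%:E
   <= (8 ^+ n * fine (mu B))%:E)%E.
Proof.
move=> N0; set V := fine (mu B).
have Cle xi : `|cos_transform xi| <= V.
  by apply: Rintegral_indic_le => // x; exact: abs_cos_le1.
have Sle xi : `|sin_transform xi| <= V.
  by apply: Rintegral_indic_le => // x; exact: abs_sin_le1.
have mphase : measurable_fun setT
    (fun z : euclid R n * euclid R n => 2 * pi * dot z.2 z.1).
  by apply: measurable_funM => //; exact: measurable_dot.
have mG : measurable_fun setT (fun z => G z.1 z.2).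
  apply: measurable_funD; apply: measurable_funM.
  - exact: measurable_cos_comp.
  - exact: (measurableT_comp measurable_cos_transform).
  - exact: measurable_sin_comp.
  - exact: (measurableT_comp measurable_sin_transform).
have G_le z : `|G z.1 z.2| <= V + V.
  apply: (le_trans (ler_normD _ _)); rewrite !normrM.
  by rewrite lerD// -[leRHS]mul1r ler_pM// ?abs_cos_le1 ?abs_sin_le1.
have iW := integrable_cube_weight n N0.
have iG := integrable_prodM_bounded iW integrable_B mG G_le.
(* The first copy of [B] is unfolded, so that Fubini can move the [xi] integral inside the [x]
   integral. *)
rewrite (_ : (\int[mu]_xi _)%E = (\int[mu]_xi \int[mu]_x
    (cube_weight N xi * \1_B x * G xi x)%:E)%E); last first.
  apply: eq_integral => xi _.
  have ic := integrable_indicM (measurable_cos_phase xi) (fun x => abs_cos_le1 _).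
  have is_ := integrable_indicM (measurable_sin_phase xi) (fun x => abs_sin_le1 _).
  have icZ := integrableZl measurableT (cube_weight N xi * cos_transform xi) ic.
  have isZ := integrableZl measurableT (cube_weight N xi * sin_transform xi) is_.
  transitivity (\int[mu]_x
     (cube_weight N xi * cos_transform xi * (cos (2 * pi * dot x xi) * \1_B x)
     + cube_weight N xi * sin_transform xi * (sin (2 * pi * dot x xi) * \1_B x))%:E)%E;
    last by apply: eq_integral => x _; rewrite /G; congr EFin; ring.
  rewrite -[RHS]fineK; last first.
    apply: integrable_fin_num => //.
    under eq_fun do rewrite EFinD !(EFinM (cube_weight _ _ * _)).
    exact: integrableD.
  rewrite -/(Rintegral _ _ _) RintegralD// !RintegralZl//.
  by rewrite -/(cos_transform xi) -/(sin_transform xi); congr EFin; ring.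
rewrite (Fubini iG)/=.
apply: (@le_trans _ _ (\int[mu]_x (8 ^+ n * \1_B x)%:E)%E); last first.
  under eq_integral do rewrite EFinM.
  rewrite ge0_integralZl//; last exact/measurable_EFinP.
  by rewrite integral_indic// setIT EFinM fineK// ge0_fin_numE// measure_lty_of_cube.
apply: integral_le_ge0; first exact: (measurable_fubini_G iG).
  by apply/measurable_EFinP; exact: measurable_funM.
move=> x; have [xB|xB] := boolP (x \in B); last first.
  rewrite indicE (negbTE xB) mulr0 integral0_eq// ?abse0//.
  by move=> xi _; rewrite mulr0 mul0r.
rewrite indicE xB mulr1.
(* With [x] fixed, the second copy of [B] is unfolded and Fubini is applied to the pair
   [(xi, y)]. *)
pose g (z : euclid R n * euclid R n) :=
  cos (2 * pi * dot x z.1 - 2 * pi * dot z.2 z.1).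
have mg : measurable_fun setT g.
  apply: measurable_cos_comp; apply: measurable_funB; last exact: mphase.
  by apply: measurable_funM => //; exact: measurable_dot.
have ig := integrable_prodM_bounded iW integrable_B mg (fun z => abs_cos_le1 _).
have -> : (\int[mu]_xi (cube_weight N xi * 1 * G xi x)%:E
  = \int[mu]_xi \int[mu]_y (cube_weight N xi * \1_B y * g (xi, y))%:E)%E.
  by apply: eq_integral => xi _; rewrite mulr1 GE.
rewrite (Fubini ig)/=.
have mI := measurable_fubini_G ig.
apply: (le_trans (le_abse_integral _ _ mI)) => //.
apply: le_trans (kernel_le x N0).
apply: ge0_le_integral => //.
- exact: measurableT_comp.
move=> y _; rewrite /fubini_G/=.
rewrite (_ : (\int[mu]_xi _)%E = (\1_B y)%:E * \int[mu]_xi (cube_weight N xi *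
    cos (\sum_(i < n) 2 * pi * (tnth x i - tnth y i) * tnth xi i + 0))%:E)%E; last first.
  rewrite -integralZl//; last exact: integrable_cube_weight_cos.
  apply: eq_integral => xi _; rewrite -EFinM /g/= phaseB; congr EFin; ring.
rewrite cube_weight_cos// cos0 mulr1 -EFinM lee_fin normrM.
by rewrite [`|\1_B y|]ger0_norm.
Qed.

End square_integrable.

(** * Removing the weight *)

Section square_integrable_limit.
Context {R : realType} {n : nat}.
Local Notation mu := (@lebesgue_euclid R n).

Lemma cvg_parabolic_weight (t : R) :
  parabolic_weight k.+1%:R t @[k --> \oo] --> (1 : R).
Proof.
apply: (squeeze_cvgr (f := fun k : nat => 1 - (t * harmonic k) ^+ 2) (h := fun=> 1)).
- by apply: nearW => k; rewrite parabolic_weight_le1 andbT le_max lexx orbT.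
- have {2}-> : 1 = 1 - (t * 0) ^+ 2 :> R by rewrite mulr0 expr0n subr0.
  apply: cvgB; first exact: cvg_cst.
  apply: (@continuous_cvg _ _ _ _ _ (fun k : nat => t * harmonic k)
    (fun u : R => u ^+ 2) (t * 0)); first exact: exprn_continuous.
  by apply: cvgM; [exact: cvg_cst|exact: cvg_harmonic].
- exact: cvg_cst.
Qed.

Lemma cvg_cube_weight (x : euclid R n) :
  cube_weight k.+1%:R x @[k --> \oo] --> (1 : R).
Proof.
have := @cvg_big R 'I_n *%R 1 predT (@mul_continuous R) nat \oo (index_enum 'I_n)
  (fun i k => parabolic_weight k.+1%:R (tnth x i)) (fun=> 1) _
  (fun i _ => @cvg_parabolic_weight (tnth x i)).
by rewrite [X in _ --> X]big1//; apply; exact: eventually_filter.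
Qed.

Lemma cube_weight_le M N (x : euclid R n) : 0 < M -> M <= N ->
  cube_weight M x <= cube_weight N x.
Proof.
move=> M0 MN; apply: ler_prod => i _.
by rewrite parabolic_weight_ge0 parabolic_weight_le.
Qed.

(** Monotone convergence along [N = k + 1]: the weights increase to 1 and the bound [C] is uniform
    in [N]. *)
Lemma integral_le_cube_weight (s : euclid R n -> R) (C : \bar R) :
  measurable_fun setT s -> (forall x, 0 <= s x) ->
  (forall N, 0 < N -> (\int[mu]_x (cube_weight N x * s x)%:E <= C)%E) ->
  (\int[mu]_x (s x)%:E <= C)%E.
Proof.
move=> ms s0 sC.
pose g k x := (cube_weight k.+1%:R x * s x)%:E.
have mg k : measurable_fun setT (g k).
  apply/measurable_EFinP; apply: measurable_funM => //.
  exact: measurable_cube_weight.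
have g0 k x : setT x -> (0 <= g k x)%E.
  by move=> _; rewrite lee_fin mulr_ge0// cube_weight_ge0.
have ndg x : setT x -> {homo g ^~ x : k l / (k <= l)%N >-> (k <= l)%E}.
  move=> _ k l kl; rewrite lee_fin ler_wpM2r// cube_weight_le//.
  by rewrite ler_nat.
rewrite (eq_integral (fun x => limn (g ^~ x))); last first.
  move=> x _; apply/esym/cvg_lim => //; apply: cvg_EFin; first exact: nearW.
  rewrite -[X in _ --> X]mul1r; apply: cvgM; last exact: cvg_cst.
  exact: cvg_cube_weight.
rewrite monotone_convergence//; apply: lime_le; last first.
  by apply: nearW => k; exact: sC.
apply: ereal_nondecreasing_is_cvgn => k l kl.
by apply: ge0_le_integral => // x _; [exact: g0|exact: ndg].
Qed.

End square_integrable_limit.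

(** * Inequalities for powers and phases *)

Section real_inequalities.
Context {R : realType}.
Implicit Types (u v t q x : R).

(** Bernoulli's inequality, written in [x] instead of [x - 1]. *)
Lemma one_sub_exprn_le x m : 0 <= x <= 1 -> 1 - x ^+ m <= m%:R * (1 - x).
Proof.
move=> /andP[x0 x1]; elim: m => [|m IH]; first by rewrite expr0 subrr mul0r.
have xm1 : x ^+ m <= 1 by rewrite exprn_ile1.
have xm0 : 0 <= x ^+ m by rewrite exprn_ge0.
rewrite exprS -natr1 mulrDl mul1r.
have : x ^+ m * (1 - x) <= 1 * (1 - x) by rewrite ler_wpM2r// subr_ge0.
lra.
Qed.

(** A mean value estimate for the power [q]. Dividing by [u] reduces it to [x = v / u] in the unit
    interval, where [x ^+ m <= x ^ q] and Bernoulli's inequality apply. The error carries a power of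
    [u], which will be the unperturbed transform, so it can be integrated independently of the
    perturbation. *)
Lemma powR_le_perturb q m u v t : 1 < q -> q <= m%:R -> 0 <= u -> 0 <= v -> 0 <= t ->
  u <= v + t -> u `^ q <= v `^ q + m%:R * t * u `^ (q - 1).
Proof.
move=> q1 qm u0 v0 t0 uvt; have q0 : 0 < q by rewrite (lt_trans _ q1).
have rhs0 : 0 <= m%:R * t * u `^ (q - 1) by rewrite !mulr_ge0// powR_ge0.
have [uv|vu] := leP u v.
  by rewrite -[leLHS]addr0 lerD// ge0_ler_powR// ltW.
have u_gt0 : 0 < u by rewrite (le_lt_trans v0).
pose x := v / u.
have x01 : 0 <= x <= 1 by rewrite divr_ge0//= ler_pdivrMr// mul1r ltW.
have xm : x ^+ m <= x `^ q.
  (* At [x = 0] the integer power vanishes only for [m > 0], which follows from [0 < q <= m]. *)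
  have [->|x0] := eqVneq x 0.
    rewrite powR0 ?gt_eqF// expr0n; case: m qm {rhs0} => [qm|m _]; last exact: lexx.
    by move: q0; rewrite ltNge (le_trans qm).
  rewrite -powR_mulrn; last by case/andP : x01.
  by apply: ger_powR => //; case/andP: x01 => x_ge0 ->; rewrite lt0r x0 x_ge0.
have -> : v `^ q = u `^ q * x `^ q.
  have [x0 _] := andP x01; rewrite -powRM ?(ltW u_gt0)//.
  by rewrite /x mulrC divfK// gt_eqF.
have uq : u `^ q = u * u `^ (q - 1) by rewrite mulr_powRB1.
set w := u `^ (q - 1) in uq rhs0 *; have w0 : 0 <= w by rewrite powR_ge0.
have h1 := one_sub_exprn_le m x01.
have h2 : u * (1 - x) <= t.
  by rewrite mulrBr mulr1 /x mulrC divfK ?gt_eqF//; lra.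
have h3 : 1 - x `^ q <= m%:R * (1 - x) by lra.
rewrite uq -lerBlDl.
have -> : u * w - u * w * x `^ q = w * (u * (1 - x `^ q)) by ring.
rewrite [leRHS]mulrC ler_wpM2l//.
apply: (@le_trans _ _ (u * (m%:R * (1 - x)))); first by rewrite ler_wpM2l// ltW.
by rewrite mulrCA ler_wpM2l.
Qed.

(** Interpolation with the supremum: for a bounded function, square integrability passes to every
    power above 2. *)
Lemma powR_le_sqr u c q : 2 < q -> 0 <= u -> u <= c -> u `^ q <= c `^ (q - 2) * u ^+ 2.
Proof.
move=> q2 u0 uc; rewrite -powR_mulrn//.
have [->|un0] := eqVneq u 0.
  by rewrite powR0 ?mulr_ge0 ?powR_ge0// gt_eqF// (lt_trans _ q2).
rewrite -[X in u `^ X <= _](subrK 2) [leLHS]powRD ?un0 ?implybT//.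
rewrite ler_wpM2r ?powR_ge0//; apply: ge0_ler_powR => //.
  by rewrite subr_ge0 ltW.
by rewrite nnegrE (le_trans u0).
Qed.

Let normcE (x y : R) : Normc.normc (Complex x y) = Num.sqrt (x ^+ 2 + y ^+ 2).
Proof. by []. Qed.

Lemma normc_le_abs (x y : R) : Normc.normc (Complex x y) <= `|x| + `|y|.
Proof.
rewrite normcE -[leRHS]ger0_norm ?addr_ge0// -sqrtr_sqr ler_wsqrtr//.
rewrite sqrrD !real_normK ?num_real// addrAC lerDl mulrn_wge0// mulr_ge0//.
Qed.

Lemma normc_expi (t : R) : Normc.normc (expi t) = 1.
Proof. by rewrite /expi normcE cos2Dsin2 sqrtr1. Qed.

Lemma expiD (s t : R) : expi (s + t) = expi s * expi t.
Proof.
by rewrite /expi cosD sinD; apply/eqP; rewrite eq_complex/= eqxx/= addrC.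
Qed.

(* The phases [z0 = i * w], [z1 = w / y], [z2 = w * y] satisfy
   [z1 * z2 + z0 ^+ 2 = 0], so they cannot all be close to [1]. *)
Lemma three_phases (l h : R) :
  2 <= 2 * Normc.normc (expi (pi / 2 - l) - 1)
     + Normc.normc (expi (- (l + h)) - 1) + Normc.normc (expi (- (l - h)) - 1).
Proof.
set z0 := expi (pi / 2 - l); set z1 := expi (- (l + h)); set z2 := expi (- (l - h)).
have e0 : z0 * z0 + z1 * z2 = 0.
  rewrite /z0 /z1 /z2 -!expiD.
  have -> : pi / 2 - l + (pi / 2 - l) = - (l + l) + pi by field.
  have -> : - (l + h) - (l - h) = - (l + l) by ring.
  by rewrite /expi cosDpi sinDpi; apply/eqP; rewrite eq_complex/= !addNr !eqxx.
(* Splitting [z0 ^+ 2 - 1] and [z1 * z2 - 1] leaves terms that each contain a difference from 1. The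
   cofactor [z0 + 1] has modulus at most 2, whence the weight 2 on the first distance. *)
have e1 : (z0 - 1) * (z0 + 1) + z1 * (z2 - 1) + (z1 - 1) = - (1 + 1).
  have -> : (z0 - 1) * (z0 + 1) + z1 * (z2 - 1) + (z1 - 1)
     = z0 * z0 + z1 * z2 - (1 + 1) by ring.
  by rewrite e0 sub0r.
have n2 : Normc.normc (- (1 + 1) : R[i]) = 2.
  by rewrite /= addr0 oppr0 expr0n/= addr0 sqrtr_sqr normrN ger0_norm.
rewrite -[leLHS]n2 -e1.
apply: (le_trans (le_normcD _ _)); rewrite [leRHS]addrAC lerD//.
apply: (le_trans (le_normcD _ _)); rewrite !Normc.normcM normc_expi mul1r lerD//.
rewrite mulrC ler_wpM2r//; first by rewrite /Normc.normc; case: (z0 - 1) => *; exact: sqrtr_ge0.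
by apply: (le_trans (le_normcD _ _)); rewrite normc_expi Normc.normc1.
Qed.

End real_inequalities.

Lemma poweR_cLnorm d (T : measurableType d) (R : realType)
    (mu : {measure set T -> \bar R}) (p : R) (D : set T) (f : T -> R[i]) : p != 0 ->
  (cLnorm mu p D f `^ p = \int[mu]_x (Normc.normc (f x) `^ p * \1_D x)%:E)%E.
Proof.
move=> p0; rewrite /cLnorm poweR_Lnorm//; apply: eq_integral => x _.
rewrite patchE indicE; case: ifPn => xD; last first.
  by rewrite abse0 poweR0r// mulr0.
rewrite mulr1 gee0_abs ?poweR_EFin// lee_fin.
by rewrite /Normc.normc; case: (f x) => a b; exact: sqrtr_ge0.
Qed.

(** * Upper bound for the deficit *)

Section phase_transform.
Context {R : realType} {n : nat}.
Local Notation mu := (@lebesgue_euclid R n).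
Variable B : set (euclid R n).
Hypotheses (mB : measurable B) (B1 : forall x, B x -> forall i, -1 <= tnth x i <= 1).
Implicit Types g : euclid R n -> R.

Definition phase_norm g (xi : euclid R n) : R :=
  Normc.normc (fourier (fun x => expi (g x) * (\1_B x)%:C%C) xi).

Let phase g xi x := g x - 2 * pi * dot x xi.

Lemma fourier_phase g xi :
  fourier (fun x => expi (g x) * (\1_B x)%:C%C) xi
  = Complex (\int[mu]_x (cos (phase g xi x) * \1_B x))
            (\int[mu]_x (sin (phase g xi x) * \1_B x)).
Proof.
have E x : expi (- (2 * pi * dot x xi)) * (expi (g x) * (\1_B x)%:C%C)
   = Complex (cos (phase g xi x) * \1_B x) (sin (phase g xi x) * \1_B x).
  rewrite mulrA -expiD addrC -/(phase g xi x) /expi.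
  by apply/eqP; rewrite eq_complex/= !mulr0 subr0 add0r !eqxx.
rewrite /fourier /cintegral; congr Complex.
  by apply: eq_Rintegral => x _; rewrite E.
by apply: eq_Rintegral => x _; rewrite E.
Qed.

Let measurable_phase2 g : measurable_fun setT g ->
  measurable_fun setT (fun z : euclid R n * euclid R n => phase g z.1 z.2).
Proof.
move=> mg; apply: measurable_funB; first exact: (measurableT_comp mg).
by apply: measurable_funM => //; exact: measurable_dot.
Qed.

Let measurable_phase g xi : measurable_fun setT g -> measurable_fun setT (phase g xi).
Proof.
move=> mg; apply: measurable_funB => //.
by apply: measurable_funM => //; exact: measurable_dot.
Qed.

Let measurable_indic2 : measurable_fun setT
  (fun z : euclid R n * euclid R n => \1_B z.2 : R).
Proof. exact: (measurableT_comp (f := (\1_B : euclid R n -> R))). Qed.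

Lemma measurable_phase_norm g : measurable_fun setT g ->
  measurable_fun setT (phase_norm g).
Proof.
move=> mg.
pose h xi := (\int[mu]_x (cos (phase g xi x) * \1_B x)) ^+ 2
           + (\int[mu]_x (sin (phase g xi x) * \1_B x)) ^+ 2.
have -> : phase_norm g = Num.sqrt \o h.
  by apply/funext => xi; rewrite /phase_norm fourier_phase.
apply: measurableT_comp.
  by apply: continuous_measurable_fun; exact: sqrt_continuous.
apply: measurable_funD; apply: measurable_funX.
- apply: (@measurable_Rintegral_param _ _ _ _ _ mu
    (fun z => cos (phase g z.1 z.2) * \1_B z.2)).
  by apply: measurable_funM => //; apply: measurable_cos_comp; exact: measurable_phase2.
- apply: (@measurable_Rintegral_param _ _ _ _ _ mu
    (fun z => sin (phase g z.1 z.2) * \1_B z.2)).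
  by apply: measurable_funM => //; apply: measurable_sin_comp; exact: measurable_phase2.
Qed.

Lemma phase_norm_ge0 g xi : 0 <= phase_norm g xi.
Proof. by rewrite /phase_norm fourier_phase; exact: sqrtr_ge0. Qed.

(* Changing a phase on a set [E] moves the transform by at most [O(|E|)]. *)
Let Rintegral_agree (E : set (euclid R n)) (f0 f1 : euclid R n -> R) :
  measurable E -> E `<=` B -> measurable_fun setT f0 -> measurable_fun setT f1 ->
  (forall x, `|f0 x| <= 1) -> (forall x, `|f1 x| <= 1) ->
  (forall x, ~ E x -> f0 x = f1 x) ->
  `|\int[mu]_x (f0 x * \1_B x) - \int[mu]_x (f1 x * \1_B x)| <= 2 * fine (mu E).
Proof.
move=> mE EB mf0 mf1 f0le f1le f01.
have E1 x : E x -> forall i, -1 <= tnth x i <= 1 by move=> /EB; exact: B1.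
rewrite -RintegralB//; [|exact: (integrable_indicM mB B1)..].
(* The integrand lives on [E], and halving the difference brings it into the range required by
   [Rintegral_indic_le] on [E]. *)
have -> : \int[mu]_x (f0 x * \1_B x - f1 x * \1_B x)
  = 2 * \int[mu]_x ((f0 x - f1 x) / 2 * \1_E x).
  rewrite -RintegralZl//.
    apply: eq_Rintegral => x _; rewrite !indicE.
    have [xE|xE] := boolP (x \in E).
      have -> : x \in B by rewrite inE; apply: EB; exact: set_mem.
      by field.
    rewrite f01; last by move/mem_set; exact/negP.
    by rewrite !subrr !mul0r mulr0.
  apply: (integrable_indicM mE E1) => //.
    by apply: measurable_funM => //; exact: measurable_funB.
  move=> x; rewrite normrM [`|2^-1|]ger0_norm// ler_pdivrMr// mul1r.
  by apply: (le_trans (ler_normB _ _)); rewrite -[leRHS]/(1 + 1 : R) lerD.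
rewrite normrM ger0_norm// ler_wpM2l//; apply: (Rintegral_indic_le mE E1).
  by apply: measurable_funM => //; exact: measurable_funB.
move=> x; rewrite normrM [`|2^-1|]ger0_norm// ler_pdivrMr// mul1r.
by apply: (le_trans (ler_normB _ _)); rewrite -[leRHS]/(1 + 1 : R) lerD.
Qed.

(** The real and imaginary parts of the difference of transforms each contribute twice the measure
    of [E]. *)
Lemma phase_norm_le (E : set (euclid R n)) g0 g1 xi :
  measurable E -> E `<=` B -> measurable_fun setT g0 -> measurable_fun setT g1 ->
  (forall x, ~ E x -> g0 x = g1 x) ->
  phase_norm g0 xi <= phase_norm g1 xi + 4 * fine (mu E).
Proof.
move=> mE EB mg0 mg1 g01; rewrite /phase_norm.
set z0 := fourier _ xi; set z1 := fourier _ xi.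
have -> : z0 = z1 + (z0 - z1) by rewrite addrC subrK.
apply: (le_trans (le_normcD _ _)); rewrite lerD2l /z0 /z1 !fourier_phase.
apply: (le_trans (normc_le_abs _ _)) => /=.
have -> : 4 * fine (mu E) = 2 * fine (mu E) + 2 * fine (mu E) by ring.
apply: lerD; apply: Rintegral_agree => //.
- by apply: measurable_cos_comp; exact: measurable_phase.
- by apply: measurable_cos_comp; exact: measurable_phase.
- by move=> x; exact: abs_cos_le1.
- by move=> x; exact: abs_cos_le1.
- by move=> x xE; rewrite /phase g01.
- by apply: measurable_sin_comp; exact: measurable_phase.
- by apply: measurable_sin_comp; exact: measurable_phase.
- by move=> x; exact: abs_sin_le1.
- by move=> x; exact: abs_sin_le1.
- by move=> x xE; rewrite /phase g01.
Qed.

Lemma phase_norm0_sqr xi : phase_norm (fun=> 0) xi ^+ 2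
  = cos_transform B xi ^+ 2 + sin_transform B xi ^+ 2.
Proof.
rewrite /phase_norm fourier_phase/= sqr_sqrtr ?addr_ge0 ?sqr_ge0//.
congr (_ ^+ 2 + _).
  by apply: eq_Rintegral => x _; rewrite /phase add0r cosN.
rewrite -[RHS]sqrrN; congr (_ ^+ 2); rewrite -[RHS]mulN1r -RintegralZl//.
  by apply: eq_Rintegral => x _; rewrite /phase add0r sinN mulN1r mulNr.
apply: (integrable_indicM mB B1); last by move=> x; exact: abs_sin_le1.
by apply: measurable_sin_comp; apply: measurable_funM => //; exact: measurable_dot.
Qed.

Lemma phase_norm0_le xi : phase_norm (fun=> 0) xi <= 2 * fine (mu B).
Proof.
rewrite /phase_norm fourier_phase; apply: (le_trans (normc_le_abs _ _)).
rewrite mulr2n mulrDl !mul1r; apply: lerD.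
- apply: Rintegral_indic_le => //; last by move=> x; exact: abs_cos_le1.
  by apply: measurable_cos_comp; exact: measurable_phase.
- apply: Rintegral_indic_le => //; last by move=> x; exact: abs_sin_le1.
  by apply: measurable_sin_comp; exact: measurable_phase.
Qed.

(** The transform is bounded by [2 * fine (mu B)], so [powR_le_sqr] reduces the claim to the square
    integral. The weighted bounds, uniform in [N], control that one. *)
Lemma integral_phase_norm0_powR r : 2 < r ->
  (\int[mu]_xi (phase_norm (fun=> 0) xi `^ r)%:E
   <= ((2 * fine (mu B)) `^ (r - 2) * (8 ^+ n * fine (mu B)))%:E)%E.
Proof.
move=> r2; set c := (2 * _) `^ _.
have m0 := @measurable_phase_norm (fun=> 0) (measurable_cst _).
apply: (@le_trans _ _ (\int[mu]_xi (c%:E * (phase_norm (fun=> 0) xi ^+ 2)%:E))%E).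
  apply: ge0_le_integral => //.
  - by move=> xi _; rewrite lee_fin powR_ge0.
  - apply/measurable_EFinP.
    exact: (measurableT_comp (measurable_powR _) m0).
  - apply: measurable_funeM; apply/measurable_EFinP; exact: measurable_funX.
  - move=> xi _; rewrite -EFinM lee_fin; apply: powR_le_sqr => //.
      exact: phase_norm_ge0.
    exact: phase_norm0_le.
rewrite ge0_integralZl//; last 3 first.
- by apply/measurable_EFinP; exact: measurable_funX.
- by move=> xi _; rewrite lee_fin sqr_ge0.
- by rewrite lee_fin powR_ge0.
rewrite EFinM lee_wpmul2l ?lee_fin ?powR_ge0//.
under eq_integral do rewrite phase_norm0_sqr.
apply: integral_le_cube_weight.
- by apply: measurable_funD; apply: measurable_funX;
    [exact: measurable_cos_transform|exact: measurable_sin_transform].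
- by move=> xi; rewrite addr_ge0 ?sqr_ge0.
- by move=> N N0; exact: weighted_square_le.
Qed.

(** [powR_le_perturb] is integrated with [t] four times the measure of [E]. The error involves the
    power [q - 1] of the unperturbed transform, integrable because [q > 3] puts that exponent above
    2. *)
Lemma phase_deficit (E : set (euclid R n)) g q m : 3 < q -> q <= m%:R ->
  measurable E -> E `<=` B -> measurable_fun setT g ->
  (forall x, ~ E x -> g x = 0) ->
  (\int[mu]_xi (phase_norm (fun=> 0) xi `^ q)%:E
   <= \int[mu]_xi (phase_norm g xi `^ q)%:E
      + (m%:R * (4 * fine (mu E)) *
         ((2 * fine (mu B)) `^ (q - 3) * (8 ^+ n * fine (mu B))))%:E)%E.
Proof.
move=> q3 qm mE EB mg gE; set t := 4 * fine _.
have t0 : 0 <= t by rewrite mulr_ge0// fine_ge0.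
have m0 := @measurable_phase_norm (fun=> 0) (measurable_cst _).
have mgn := measurable_phase_norm mg.
have mp g' r : measurable_fun setT (phase_norm g') ->
    measurable_fun setT (fun xi => (phase_norm g' xi `^ r)%:E).
  by move=> mg'; apply/measurable_EFinP; exact: (measurableT_comp (measurable_powR _) mg').
apply: (@le_trans _ _ (\int[mu]_xi ((phase_norm g xi `^ q)%:E
    + (m%:R * t)%:E * (phase_norm (fun=> 0) xi `^ (q - 1))%:E))%E).
  apply: ge0_le_integral => //.
  - by move=> xi _; rewrite lee_fin powR_ge0.
  - exact: mp.
  - by apply: emeasurable_funD; [exact: mp|apply: measurable_funeM; exact: mp].
  - move=> xi _; rewrite -EFinM -EFinD lee_fin.
    apply: powR_le_perturb; rewrite ?phase_norm_ge0//; first lra.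
    by apply: phase_norm_le => // x xE; rewrite gE.
rewrite ge0_integralD//; last 4 first.
- by move=> xi _; rewrite lee_fin powR_ge0.
- exact: mp.
- by move=> xi _; rewrite mule_ge0// lee_fin ?powR_ge0// mulr_ge0.
- by apply: measurable_funeM; exact: mp.
rewrite leeD2l// ge0_integralZl//; last 3 first.
- exact: mp.
- by move=> xi _; rewrite lee_fin powR_ge0.
- by rewrite lee_fin mulr_ge0.
rewrite [leRHS]EFinM; apply: lee_wpmul2l; first by rewrite lee_fin mulr_ge0.
have -> : q - 3 = q - 1 - 2 by ring.
by apply: integral_phase_norm0_powR; lra.
Qed.

End phase_transform.

(** * Lower bound for the distance to affine phases *)

Section geometry.
Context {R : realType}.

Lemma measurable_unit_ball n : measurable (@unit_ball R n).
Proof.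
have md : measurable_fun setT (fun x : euclid R n => dot x x) by exact: measurable_dot.
have ms : measurable_fun setT (fun x : euclid R n => Num.sqrt (dot x x)).
  apply: (measurableT_comp _ md).
  by apply: continuous_measurable_fun; exact: sqrt_continuous.
have := ms measurableT `]-oo, 1]%classic (measurable_itv _).
by rewrite setTI.
Qed.

Lemma sqr_tnth_le_dot n (x : euclid R n) i : tnth x i ^+ 2 <= dot x x.
Proof.
rewrite /dot (bigD1 i)//= -expr2 lerDl sumr_ge0// => j _.
by rewrite -expr2 sqr_ge0.
Qed.

Lemma unit_ball_coord n (x : euclid R n) : unit_ball x -> forall i, -1 <= tnth x i <= 1.
Proof.
rewrite /unit_ball/= => xB i; rewrite -ler_norml -sqrtr_sqr.
by apply: le_trans xB; rewrite ler_wsqrtr// sqr_tnth_le_dot.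
Qed.

Definition cube n (s : R) : set (euclid R n) :=
  [set x | forall i, `[- s, s]%classic (tnth x i)].

Lemma measurable_cube n s : measurable (@cube n s).
Proof. exact: (@measurable_box R n (fun=> `[- s, s]%classic)). Qed.

Lemma lebesgue_cube n s : 0 < s -> @lebesgue_euclid R n (@cube n s) = ((2 * s) ^+ n)%:E.
Proof.
move=> s0; rewrite (@lebesgue_euclid_box R n (fun=> `[- s, s]%classic))//.
rewrite (eq_bigr (fun=> (2 * s)%:E)); last first.
  move=> i _; rewrite /= lebesgue_measure_itv/= lte_fin gtrN// -EFinB.
  by congr EFin; ring.
by rewrite prodEFin prodr_const card_ord.
Qed.

(** In each square one factor is bounded by 1 and the other by [n.+1%:R^-1], so the [n.+1] squares
    sum to at most 1. *)
Lemma unit_ball_sup n (x : euclid R n.+1) :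
  (forall i, `|tnth x i| <= n.+1%:R^-1) -> unit_ball x.
Proof.
move=> xn; rewrite /unit_ball/= -[leRHS]sqrtr1 ler_wsqrtr//.
have n1 : n.+1%:R^-1 <= 1 :> R by rewrite invf_le1// ler1n.
apply: (@le_trans _ _ (\sum_(i < n.+1) n.+1%:R^-1)).
  apply: ler_sum => i _; rewrite -expr2 -real_normK ?num_real//.
  have x0 := normr_ge0 (tnth x i); have xi := xn i.
  by rewrite expr2 -[leRHS]mulr1 ler_pM// (le_trans xi).
by rewrite sumr_const card_ord -[leLHS]mulr_natr mulVf ?pnatr_eq0.
Qed.

Lemma tnth_shift_head0 n t (x : euclid R n.+1) :
  tnth (shift_head t x) ord0 = tnth x ord0 + t.
Proof. by []. Qed.

Lemma tnth_shift_headS n t (x : euclid R n.+1) i :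
  tnth (shift_head t x) (lift ord0 i) = tnth x (lift ord0 i).
Proof.
rewrite tnth_cons_pairS tnth_behead; congr tnth; apply/val_inj.
by rewrite /= inordK// ltnS.
Qed.

Lemma dot_shift_head n t (a x : euclid R n.+1) :
  dot a (shift_head t x) = dot a x + tnth a ord0 * t.
Proof.
rewrite /dot !big_ord_recl tnth_shift_head0.
under eq_bigr do rewrite tnth_shift_headS.
by ring.
Qed.

End geometry.

Section lower_bound.
Context {R : realType} {n : nat}.
Local Notation mu := (@lebesgue_euclid R n.+1).

(** Half the radius of the sup-norm ball in [unit_ball_sup]. A cube of half-side at most [r / 4] and
    its shifts by [r] and [- r] along the first axis all fit in the unit ball, and the shifts miss
    the cube. *)
Let r : R := (2 * n.+1%:R)^-1.

Lemma cube_sub_unit_ball s : s <= r / 4 -> @cube R n.+1 s `<=` unit_ball.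
Proof.
move=> sr x xs; apply: unit_ball_sup => i.
have rE : n.+1%:R^-1 = 2 * r by rewrite /r invfM mulrA divff// mul1r.
have r0 : 0 < r by rewrite invr_gt0 mulr_gt0// ltr0n.
by have := xs i; rewrite /= in_itv/= -ler_norml rE; lra.
Qed.

Lemma shift_cube s (x : euclid R n.+1) (e : R) : 0 < s -> s <= r / 4 ->
  `|e| = r -> cube s x -> unit_ball (shift_head e x) /\ ~ cube s (shift_head e x).
Proof.
move=> s0 sr er xs.
have n0 : 0 < n.+1%:R :> R by rewrite ltr0n.
have rE : n.+1%:R^-1 = 2 * r by rewrite /r invfM mulrA divff// mul1r.
have xi i : `|tnth x i| <= s by have := xs i; rewrite /= in_itv/= ler_norml.
split; last first.
  move=> /(_ ord0); rewrite /= tnth_shift_head0 in_itv/= -ler_norml => h.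
  have : `|e| <= `|tnth x ord0 + e| + `|tnth x ord0|.
    by rewrite -[X in `|X| <= _](addKr (tnth x ord0)) addrC ler_normB.
  have := xi ord0; rewrite er; lra.
apply: unit_ball_sup => i; rewrite rE.
case: (unliftP ord0 i) => [j ->|->].
  rewrite tnth_shift_headS; have := xi (lift ord0 j); lra.
rewrite tnth_shift_head0 (le_trans (ler_normD _ _))// er.
have := xi ord0; lra.
Qed.

Definition quarter_phase s (x : euclid R n.+1) : R := pi / 2 * \1_(cube s) x.

Lemma measurable_quarter_phase s : measurable_fun setT (quarter_phase s).
Proof. by apply: measurable_funM => //; apply: measurable_indic; exact: measurable_cube. Qed.

Let affine_dist s (L : euclid R n.+1 -> R) (x : euclid R n.+1) : R :=
  Normc.normc (expi (quarter_phase s x - L x) - 1).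

Let measurable_affine_dist s L : is_affine L -> measurable_fun setT (affine_dist s L).
Proof.
move=> [a [b Lab]].
have mL : measurable_fun setT L.
  rewrite (_ : L = fun x => dot a x + b); last exact/funext.
  by apply: measurable_funD => //; exact: measurable_dot.
have mqL : measurable_fun setT (fun x => quarter_phase s x - L x).
  by apply: measurable_funB => //; exact: measurable_quarter_phase.
pose h x := (cos (quarter_phase s x - L x) - 1) ^+ 2
  + (sin (quarter_phase s x - L x)) ^+ 2.
have -> : affine_dist s L = Num.sqrt \o h.
  by apply/funext => x; rewrite /affine_dist /expi /= subr0.
apply: measurableT_comp.
  by apply: continuous_measurable_fun; exact: sqrt_continuous.
apply: measurable_funD; apply: measurable_funX.
  by apply: measurable_funB => //; exact: measurable_cos_comp.
exact: measurable_sin_comp.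
Qed.

Let affine_dist_ge0 s L x : 0 <= affine_dist s L x.
Proof. by rewrite /affine_dist /expi /=; exact: sqrtr_ge0. Qed.

(* At one of the three points [x], [x + r e_1], [x - r e_1] the function
   [expi (quarter_phase - L)] is at distance at least [1 / 2] from [1]. *)
Let affine_dist_cube p s L x : 1 <= p -> 0 < s -> s <= r / 4 ->
  is_affine L -> cube s x ->
  2^-1 `^ p <= affine_dist s L x `^ p + affine_dist s L (shift_head r x) `^ p
     + affine_dist s L (shift_head (- r) x) `^ p.
Proof.
move=> p1 s0 sr [a [b Lab]] xs.
have r0 : 0 < r by rewrite invr_gt0 mulr_gt0// ltr0n.
have [_ rx] := shift_cube s0 sr (gtr0_norm r0) xs.
have Nr : `|- r| = r by rewrite normrN gtr0_norm.
have [_ Nrx] := shift_cube s0 sr Nr xs.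
have p0 : 0 <= p by lra.
have big y : 2^-1 <= affine_dist s L y -> 2^-1 `^ p <= affine_dist s L y `^ p.
  by move=> h; apply: ge0_ler_powR; rewrite ?nnegrE.
(* Shifting by [r] or [- r] changes [L] by plus or minus [tnth a ord0 * r], and [quarter_phase]
   vanishes at both shifted points. *)
have := three_phases (L x) (tnth a ord0 * r).
have -> : pi / 2 - L x = quarter_phase s x - L x.
  by rewrite /quarter_phase indicE mem_set// mulr1.
have -> : - (L x + tnth a ord0 * r)
    = quarter_phase s (shift_head r x) - L (shift_head r x).
  by rewrite /quarter_phase indicE memNset// mulr0 sub0r !Lab dot_shift_head; ring.
have -> : - (L x - tnth a ord0 * r)
    = quarter_phase s (shift_head (- r) x) - L (shift_head (- r) x).
  by rewrite /quarter_phase indicE memNset// mulr0 sub0r !Lab dot_shift_head; ring.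
rewrite -!/(affine_dist _ _ _).
set u := affine_dist s L x; set v := affine_dist s L _; set w := affine_dist s L _ => h.
have up := powR_ge0 u p; have vp := powR_ge0 v p; have wp := powR_ge0 w p.
(* If all three distances were below one half, [2 * u + v + w] would be below 2. *)
have [/big|u2] := leP 2^-1 u; first by rewrite -/u; lra.
have [/big|v2] := leP 2^-1 v; first by rewrite -/v; lra.
have [/big|w2] := leP 2^-1 w; first by rewrite -/w; lra.
lra.
Qed.

(** [affine_dist_cube] is integrated over the cube. By translation invariance each of its three
    terms contributes at most the same integral over the unit ball, which explains the division by
    3. *)
Lemma phase_distance_ge p s (L : euclid R n.+1 -> R) : 1 <= p -> 0 < s -> s <= r / 4 ->
  is_affine L ->
  (((2^-1 `^ p / 3 * (2 * s) ^+ n.+1) `^ p^-1)%:E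
   <= cLnorm mu p unit_ball (fun x => (expi (quarter_phase s x - L x) - 1)%R))%E.
Proof.
move=> p1 s0 sr aL; have p0 : 0 < p by lra.
have p0' : p != 0 by rewrite gt_eqF.
have r0 : 0 < r by rewrite invr_gt0 mulr_gt0// ltr0n.
have Nr : `|- r| = r by rewrite normrN gtr0_norm.
set k := _ / _ * _; have k0 : 0 <= k.
  by rewrite mulr_ge0 ?divr_ge0 ?powR_ge0// exprn_ge0// mulr_ge0// ltW.
set N := cLnorm _ _ _ _.
have N0 : (0 <= N)%E by exact: Lnorm_ge0.
have -> : N = ((N `^ p) `^ p^-1)%E by rewrite -poweRrM divff// poweRe1.
rewrite -poweR_EFin; apply: gt0_ler_poweR.
- by rewrite invr_ge0 ltW.
- by rewrite in_itv/= lee_fin leey andbT.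
- by rewrite in_itv/= poweR_ge0 leey.
rewrite /N poweR_cLnorm//.
pose Phi x := (affine_dist s L x `^ p * \1_unit_ball x)%:E.
have mPhi : measurable_fun setT Phi.
  apply/measurable_EFinP; apply: measurable_funM.
    by apply: (measurableT_comp (measurable_powR _)); exact: measurable_affine_dist.
  by apply: measurable_indic; exact: measurable_unit_ball.
have Phi0 x : (0 <= Phi x)%E by rewrite lee_fin mulr_ge0 ?powR_ge0.
have mS e : measurable_fun setT (fun x => Phi (shift_head e x)).
  by apply: (measurableT_comp mPhi); exact: measurable_shift_head.
rewrite -/(Phi _); set J := (\int[mu]_x Phi x)%E.
(* [J] may be infinite, so the division by 3 is done by cases on [J]. *)
suff : ((2^-1 `^ p * (2 * s) ^+ n.+1)%:E <= J + J + J)%E.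
  have J0 : (0 <= J)%E by exact: integral_ge0.
  move: J0; case: J => [j| |]//= _; last by move=> _; rewrite leey.
  by rewrite !lee_fin /k => h; lra.
have JE : (J + J + J = \int[mu]_x (Phi x + Phi (shift_head r x) + Phi (shift_head (- r) x)))%E.
  rewrite ge0_integralD//; last 2 first.
  - by move=> x _; rewrite adde_ge0.
  - exact: emeasurable_funD.
  by rewrite ge0_integralD// !ge0_integral_shift_head.
rewrite JE.
apply: (@le_trans _ _ (\int[mu]_x ((2^-1 `^ p)%:E * (\1_(cube s) x)%:E))%E).
  rewrite ge0_integralZl//; last first.
    by apply/measurable_EFinP; apply: measurable_indic; exact: measurable_cube.
  rewrite integral_indic ?setIT//; last exact: measurable_cube.
  by rewrite -[X in (_ <= _ * X)%E]/(mu (cube s)) lebesgue_cube.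
apply: ge0_le_integral => //.
- apply: measurable_funeM; apply/measurable_EFinP.
  by apply: measurable_indic; exact: measurable_cube.
- by apply: emeasurable_funD => //; exact: emeasurable_funD.
- move=> x _; have [xs|xs] := pselect (cube s x); last first.
    by rewrite indicE memNset// mule0 !adde_ge0.
  rewrite indicE mem_set// mule1 /Phi -!EFinD lee_fin.
  have [rx _] := shift_cube s0 sr (gtr0_norm r0) xs.
  have [Nrx _] := shift_cube s0 sr Nr xs.
  have xB := cube_sub_unit_ball sr xs.
  (* The point and both of its shifts lie in the unit ball, so the three cut-offs inside [Phi] equal
     1. *)
  rewrite !indicE !mem_set// !mulr1.
  exact: affine_dist_cube.
Qed.

End lower_bound.

(** * Comparison of exponents and conclusion *)

Lemma exponent_le2 (R : realType) (p c K k s0 : R) (n : nat) :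
  0 < p -> 0 < c -> 0 <= K -> 0 < k -> 0 < s0 ->
  (forall s, 0 < s -> s <= s0 ->
     c * (((k * (2 * s) ^+ n.+1) `^ p^-1) ^+ 2) <= K * (2 * s) ^+ n.+1) -> p <= 2.
Proof.
move=> p0 c0 K0 k0 s00 H; rewrite leNgt; apply/negP => p2.
(* With [D = (2 * s) ^+ n.+1], the hypothesis divided by [D ^ (2 / p)] reads [C <= K * D ^ e]. For
   [p > 2] the exponent [e] is positive, and small [D] gives a contradiction. *)
pose e := 1 - 2 / p.
have e0 : 0 < e by rewrite subr_gt0 ltr_pdivrMr// mul1r.
pose C := c * k `^ (2 / p).
have C0 : 0 < C by rewrite mulr_gt0// powR_gt0.
(* Chosen so that [y ^ e = C / (K + 1)]. The denominator [K + 1] stays positive when [K = 0] and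
   makes the final inequality strict. *)
pose y := (C / (K + 1)) `^ e^-1.
have y0 : 0 < y by rewrite powR_gt0// divr_gt0//; lra.
(* The bound [2^-1] gives [2 * s <= 1], hence [D <= 2 * s]; the bound [y / 2] then gives
   [D <= y]. *)
pose s := Num.min s0 (Num.min (y / 2) (2^-1)).
have s_gt0 : 0 < s by rewrite !lt_min s00 !divr_gt0/=.
have ss0 : s <= s0 by rewrite ge_min lexx.
have sy : 2 * s <= y.
  by rewrite mulrC -ler_pdivlMr// !ge_min lexx orbT.
have s1 : 2 * s <= 1.
  by rewrite mulrC -ler_pdivlMr// mul1r !ge_min lexx !orbT.
pose D := (2 * s) ^+ n.+1.
have D0 : 0 < D by rewrite exprn_gt0// mulr_gt0.
have Dy : D <= y.
  rewrite (le_trans _ sy)// /D exprS ler_piMr ?mulr_ge0 ?(ltW s_gt0)//.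
  by rewrite exprn_ile1 ?mulr_ge0 ?(ltW s_gt0).
have := H s s_gt0 ss0; rewrite -/D.
have -> : ((k * D) `^ p^-1) ^+ 2 = k `^ (2 / p) * D `^ (2 / p).
  by rewrite -powR_mulrn ?powR_ge0// -powRrM powRM ?(ltW k0) ?(ltW D0)// [p^-1 * _]mulrC.
have {2}-> : D = D `^ (2 / p) * D `^ e.
  rewrite -powRD; last by rewrite (gt_eqF D0) implybT.
  by rewrite /e addrC subrK powRr1 ?(ltW D0).
rewrite mulrA -/C mulrCA [leRHS]mulrC ler_pM2r ?powR_gt0//.
have De : D `^ e <= C / (K + 1).
  have -> : C / (K + 1) = y `^ e.
    by rewrite /y -powRrM mulVf ?gt_eqF// powRr1// divr_ge0 ?ltW//; lra.
  by apply: ge0_ler_powR => //; rewrite ?nnegrE ltW.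
move=> CK.
have : C <= K * (C / (K + 1)) by rewrite (le_trans CK)// ler_wpM2l.
rewrite mulrA ler_pdivlMr; last by lra.
by rewrite mulrDr mulr1 mulrC gerDl leNgt C0.
Qed.

Lemma poweR_cLnorm_fourier (R : realType) n (q : R) (f : euclid R n -> R[i]) : q != 0 ->
  (cLnorm (@lebesgue_euclid R n) q setT (fourier f) `^ q
   = \int[@lebesgue_euclid R n]_xi (Normc.normc (fourier f xi) `^ q)%:E)%E.
Proof.
move=> q0; rewrite poweR_cLnorm//; apply: eq_integral => xi _.
by rewrite indicT mulr1.
Qed.

Lemma indic_phase0 (R : realType) n (B : set (euclid R n)) :
  (fun x => (\1_B x : R)%:C%C) = (fun x => expi 0 * (\1_B x)%:C%C).
Proof.
apply/funext => x; rewrite /expi cos0 sin0; apply/eqP.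
by rewrite eq_complex/= !mul1r !mul0r subr0 addr0 !eqxx.
Qed.

(** Chaining the two middle inequalities bounds [a0] by [a0 - e + y], and [a0] cancels because it is
    finite. *)
Lemma ereal_gap_le (R : realType) (a0 a1 e : \bar R) (x y : R) :
  (0 <= a0)%E -> (a0 < +oo)%E -> (a0 <= a1 + y%:E)%E -> (a1 <= a0 - e)%E ->
  (x%:E <= e)%E -> x <= y.
Proof.
case: a0 => [a0||]//; case: a1 => [a1||]//; case: e => [e||]//=.
by rewrite -!EFinB -!EFinD !lee_fin => _ _; lra.
Qed.

(** The deficit is at least [c * k] by the stability inequality and at most a multiple of the
    measure of the cube by [phase_deficit]. [I] stands for the infimum of the squared distances to
    affine phases. *)
Lemma phase_stability_bound (R : realType) n (q c k s : R) (m : nat) (I : \bar R) :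
  3 < q -> q <= m%:R -> 0 < c -> 0 < s -> s <= (2 * n.+1%:R)^-1 / 4 ->
  (k%:E <= I)%E ->
  (\int[@lebesgue_euclid R n.+1]_xi
       (phase_norm unit_ball (quarter_phase s) xi `^ q)%:E
   <= \int[@lebesgue_euclid R n.+1]_xi (phase_norm unit_ball (fun=> 0) xi `^ q)%:E
      - c%:E * I)%E ->
  c * k <= m%:R * 4 * ((2 * fine (@lebesgue_euclid R n.+1 unit_ball)) `^ (q - 3)
    * (8 ^+ n.+1 * fine (@lebesgue_euclid R n.+1 unit_ball))) * (2 * s) ^+ n.+1.
Proof.
move=> q3 qm c0 s0 ss0 kI HI; set V := fine _.
have mB := @measurable_unit_ball R n.+1.
have q2 : 2 < q by lra.
have g0 (x : euclid R n.+1) : ~ cube s x -> quarter_phase s x = 0.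
  by move=> xs; rewrite /quarter_phase indicE memNset// mulr0.
have := phase_deficit mB (@unit_ball_coord R n.+1) q3 qm (@measurable_cube R n.+1 s)
  (cube_sub_unit_ball ss0) (measurable_quarter_phase s) g0.
have cI : ((c * k)%:E <= c%:E * I)%E.
  by rewrite EFinM lee_wpmul2l// lee_fin ltW.
have -> : fine (@lebesgue_euclid R n.+1 (cube s)) = (2 * s) ^+ n.+1.
  by rewrite lebesgue_cube.
rewrite -/V.
have -> : m%:R * 4 * ((2 * V) `^ (q - 3) * (8 ^+ n.+1 * V)) * (2 * s) ^+ n.+1
  = m%:R * (4 * (2 * s) ^+ n.+1) * ((2 * V) `^ (q - 3) * (8 ^+ n.+1 * V)) by ring.
move=> deficit; apply: (ereal_gap_le _ _ deficit HI cI).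
  by apply: integral_ge0 => xi _; rewrite lee_fin powR_ge0.
apply: le_lt_trans (ltry _).
exact: (integral_phase_norm0_powR mB (@unit_ball_coord R n.+1) q2).
Qed.

Unset Implicit Arguments.

Theorem proposition8p5 (R : realType) (d qbar : nat) (hd : (1 <= d)%N)
    (hqbar : (4 <= qbar)%N) (qbar_even : ~~ odd qbar) :
  exists rho : R, 0 < rho /\
    forall p : R, 1 <= p ->
    (exists q : R, [/\ 3 < q, `|q - qbar%:R| < rho &
      exists c : R, 0 < c /\
        forall g : euclid R d -> R, measurable_fun setT g ->
          (cLnorm (@lebesgue_euclid R d) q setT
             (fourier (fun x => (expi (g x) * (\1_unit_ball x)%:C%C)%R)) `^ q
           <= cLnorm (@lebesgue_euclid R d) q setT
                (fourier (fun x => ((\1_unit_ball x)%R)%:C%C)) `^ q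
              - c%:E * ereal_inf
                  [set cLnorm (@lebesgue_euclid R d) p unit_ball
                         (fun x => expi (g x - L x) - 1)%R ^+ 2
                  | L in [set L : euclid R d -> R | is_affine L]])%E]) ->
    p <= 2.
Proof.
case: d hd => // n _; exists 1; split=> // p p1 [q [q3 _ [c [c0 H]]]].
have p0 : 0 < p by lra.
have q0 : q != 0 by rewrite gt_eqF//; lra.
have mB := @measurable_unit_ball R n.+1.
pose V : R := fine (lebesgue_euclid (@unit_ball R n.+1)).
have V0 : 0 <= V by rewrite fine_ge0.
(* An integer above [q], as required by the Bernoulli argument in [powR_le_perturb]. *)
have [m qm] : exists m : nat, q <= m%:R.
  by exists (Num.bound q); rewrite ltW// archi_boundP//; lra.
(* The factor of [(2 * s) ^+ n.+1] in [phase_stability_bound]; it does not depend on [s]. *)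
pose K := m%:R * 4 * ((2 * V) `^ (q - 3) * (8 ^+ n.+1 * V)).
have K0 : 0 <= K by rewrite !mulr_ge0 ?powR_ge0 ?exprn_ge0.
pose s0 : R := (2 * n.+1%:R)^-1 / 4.
have s00 : 0 < s0 by rewrite divr_gt0// invr_gt0 mulr_gt0// ltr0n.
have k0 : 0 < 2^-1 `^ p / 3 :> R by rewrite divr_gt0// powR_gt0// invr_gt0.
apply: (@exponent_le2 R p c K (2^-1 `^ p / 3) s0 n) => // s s_gt0 ss0.
(* The lower bound of [phase_distance_ge] is uniform in [L], so its square passes to the infimum. *)
have I_ge : (((2^-1 `^ p / 3 * (2 * s) ^+ n.+1) `^ p^-1 ^+ 2)%:E <= ereal_inf
    [set cLnorm (@lebesgue_euclid R n.+1) p unit_ball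
           (fun x => expi (quarter_phase s x - L x) - 1)%R ^+ 2
    | L in [set L : euclid R n.+1 -> R | is_affine L]])%E.
  apply: le_ereal_inf_tmp => _ [L aL <-].
  have h := phase_distance_ge p1 s_gt0 ss0 aL.
  by rewrite expr2 EFinM expe2 lee_pmul// lee_fin powR_ge0.
apply: (phase_stability_bound q3 qm c0 s_gt0 ss0 I_ge).
have := H (quarter_phase s) (measurable_quarter_phase s).
(* Writing the indicator with the zero phase turns both sides of the hypothesis into integrals of
   powers of [phase_norm]. *)
rewrite indic_phase0 (poweR_cLnorm_fourier _ q0) (poweR_cLnorm_fourier _ q0).
exact.
Qed.
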